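(* For $n\ge 1$ and $R>0$, the magnitude of the homogeneous $n$-sphere $S^n_R$ of radius $R$ with its intrinsic metric is given by $$\left|S^n_R\right|=\begin{cases} \dfrac{2\Bigl(\bigl(\frac{R}{n-1}\bigr)^2+1\Bigr)\Bigl(\bigl(\frac{R}{n-3}\bigr)^2+1\Bigr)\cdots\Bigl(\bigl(\frac{R}{1}\bigr)^2+1\Bigr)}{1+e^{-\pi R}} & \text{for } n \text{ even},\\[1.5em] \dfrac{\pi R\Bigl(\bigl(\frac{R}{n-1}\bigr)^2+1\Bigr)\Bigl(\bigl(\frac{R}{n-3}\bigr)^2+1\Bigr)\cdots\Bigl(\bigl(\frac{R}{2}\bigr)^2+1\Bigr)}{1-e^{-\pi R}} & \text{for } n \text{ odd}, \end{cases}$$ where for $n=1$ the numerator is interpreted as being $\pi R$. (The product runs over denominators $n-1,n-3,\dots$ decreasing in steps of two, down to $1$ if $n$ is even and down to $2$ if $n$ is odd.)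
   Context: $S^n_R$ denotes the $n$-sphere of radius $R$ (constant curvature $1/R^2$ when $n\ge2$), regarded as a metric space with its intrinsic metric: the distance between two points is the infimum of the lengths of the paths in the sphere joining them. A weight measure on a metric space $(X,d)$ is a finite signed Borel measure $\nu$ on $X$ such that $\int_{x\in X}e^{-d(x,y)}\,d\nu(x)=1$ for all $y\in X$. If a weight measure $\nu$ exists on $X$, the magnitude of $X$ is defined to be its total mass $|X|:=\nu(X)$ (which does not depend on the choice of weight measure). *)

(* Defs.v *)
From HB Require Import structures.
From mathcomp Require Import all_boot all_order all_algebra.
From mathcomp Require Import all_classical all_reals all_analysis.

Set Implicit Arguments.
Unset Strict Implicit.
Unset Printing Implicit Defensive.

Import Order.TTheory GRing.Theory Num.Theory.
Import numFieldNormedType.Exports.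

Local Open Scope classical_set_scope.
Local Open Scope ring_scope.

(* The library's norm on row vectors is the sup norm; it gives the same
   topology as enorm but not the same lengths. *)
Definition enorm {R : realType} {m : nat} (u : 'rV[R]_m) : R :=
  Num.sqrt (\sum_(i < m) u 0 i ^+ 2).

(* The same sum as [variation a b g s], for a vector-valued g. *)
Definition polygon_length {R : realType} {m : nat} (a b : R)
    (g : R -> 'rV[R]_m) (s : seq R) : R :=
  \sum_(0 <= i < size s)
    enorm (g (nth b (a :: s) i.+1) - g (nth b (a :: s) i)).

Definition path_length {R : realType} {m : nat} (a b : R)
    (g : R -> 'rV[R]_m) : \bar R :=
  ereal_sup [set (polygon_length a b g s)%:E | s in itv_partition a b].

Definition sphere {R : realType} (n : nat) (r : {posnum R}) : Type :=
  {x : 'rV[R]_n.+1 | enorm x == r%:num}.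

HB.instance Definition _ (R : realType) (n : nat) (r : {posnum R}) :=
  Choice.on (sphere n r).

Lemma enorm_pole (R : realType) (n : nat) (r : {posnum R}) :
  enorm (r%:num *: delta_mx 0 0 : 'rV[R]_n.+1) == r%:num.
Proof.
rewrite /enorm (bigD1 ord0) //= big1 => [|i /negPf i0].
  by rewrite !mxE !eqxx mulr1 addr0 sqrtr_sqr ger0_norm.
by rewrite !mxE i0 andbF mulr0 expr0n.
Qed.

(* A measurable type must be inhabited. *)
HB.instance Definition _ (R : realType) (n : nat) (r : {posnum R}) :=
  isPointed.Build (sphere n r)
    (exist (fun x : 'rV[R]_n.+1 => enorm x == r%:num) _ (enorm_pole n r)).

Definition sphere_path {R : realType} {n : nat} {r : {posnum R}}
    (x y : sphere n r) (g : R -> sphere n r) : Prop :=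
  [/\ {within `[0, 1], continuous (fun t => sval (g t) : 'rV[R]_n.+1)},
      g 0 = x & g 1 = y].

(* For n >= 1 any two points are joined by a path of finite length, so that
   the infimum is a nonnegative real and [fine] loses nothing. *)
Definition sphere_dist {R : realType} {n : nat} {r : {posnum R}}
    (x y : sphere n r) : R :=
  fine (ereal_inf
    [set path_length 0 1 (fun t => sval (g t)) | g in sphere_path x y]).

Definition metric_open {R : realType} {X : Type} (dist : X -> X -> R) :
    set (set X) :=
  [set A | forall x, A x ->
    exists2 e : R, 0 < e & [set y | dist x y < e] `<=` A].

Definition borelType {R : realType} {X : pointedType} (dist : X -> X -> R) :
    measurableType (metric_open dist).-sigma :=
  g_sigma_algebraType (metric_open dist).

(* The integral against nu is the difference of the integrals against the two
   parts of its Jordan decomposition; it does not depend on which Hahn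
   decomposition (P, N) is chosen. *)
Definition charge_integral {d : measure_display} {T : measurableType d}
    {R : realType} (nu : {charge set T -> \bar R}) (f : T -> \bar R) : \bar R :=
  let: exist P exN := cid (Hahn_decomposition nu) in
  let: exist N nuPN := cid exN in
  (\int[jordan_pos nuPN]_x f x - \int[jordan_neg nuPN]_x f x)%E.

Definition weight_measure {R : realType} {X : pointedType}
    (dist : X -> X -> R) (nu : {charge set (borelType dist) -> \bar R}) : Prop :=
  forall y : X, charge_integral nu (fun x => (expR (- dist x y))%:E) = 1%E.

(* The total mass is the same for all weight measures, hence [forall nu]. *)
Definition has_magnitude {R : realType} {X : pointedType}
    (dist : X -> X -> R) (m : R) : Prop :=
  (exists nu : {charge set (borelType dist) -> \bar R}, weight_measure nu) /\
  (forall nu : {charge set (borelType dist) -> \bar R},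
    weight_measure nu -> nu [set: X] = m%:E).

(* Main.v *)
Require Import Defs.
From HB Require Import structures.
From mathcomp Require Import all_boot all_order all_algebra.
From mathcomp Require Import all_classical all_reals all_analysis.
From mathcomp Require Import measurable_realfun.
From mathcomp Require Import zify ring lra.

Set Implicit Arguments.
Unset Strict Implicit.
Unset Printing Implicit Defensive.

Import Order.TTheory GRing.Theory Num.Theory.
Import numFieldNormedType.Exports.

Local Open Scope classical_set_scope.
Local Open Scope ring_scope.

(** The sphere is homogeneous, so a multiple of its uniform probability measure
    is a weight measure: the potential x |-> \int exp(- d(x, y)) of that measure
    does not depend on x. The magnitude is then the reciprocal of this constant,
    because integrating exp(- d) against the uniform measure and any other weight
    measure, in both orders, shows that all weight measures have the same total
    mass (has_magnitude_constant_potential).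

    The intrinsic distance is r times the angle between the vectors (sphere_distE).
    A great circle shows that it is not larger. Conversely, a path is at least as
    long as its inscribed polygons; their chords, once short, are almost as long
    as the arcs that they span, and the angles satisfy the triangle inequality.

    No rotation-invariant measure is constructed from a group. The uniform law on
    S^(n + 1) is obtained from the one on S^n by drawing an independent angle t to
    the first axis, with density proportional to sin^n t. Constancy of its
    potential is proved by moments: for a random unit vector phi with this law,
    the k-th moment of the inner product of phi and y is a constant times the k-th
    power of the norm of y. This goes through the recursion by the binomial
    formula (uniform_on_sphereS), where only integrals of cos^p sin^q over [0, pi]
    occur. Hence, for every unit vector y, the inner product with y has the moments
    of cos t, for t of density proportional to sin^(n - 1) on S^n. By Weierstrass'
    approximation theorem it then has the same mean under every continuous
    function, in particular under u |-> exp(- r arccos u) (mean_exp_angle).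

    The potential is therefore the quotient of the integrals over [0, pi] of
    exp(- r t) sin^(n - 1) t and of sin^(n - 1) t. Integrating by parts relates
    the cases n and n + 2 of both integrals, and the quotient acquires a factor
    (r / (n + 1))^2 + 1 in the denominator: this is the product in the formula
    (beta_trig_exp_sin). *)

(** * Trigonometric inequalities *)

Section Trigonometry.
Variable R : realType.
Implicit Types x y t e : R.

Lemma cos_half x : cos x = 1 - 2 * sin (x / 2) ^+ 2.
Proof.
have -> : cos x = cos (x / 2 *+ 2) by congr cos; rewrite -mulr_natr divfK.
by rewrite cos_mulr2n cos2sin2; ring.
Qed.

Lemma ler_cos : {in `[0, pi] &, {mono (@cos R) : x y /~ y <= x}}.
Proof. by move=> x y xI yI; rewrite !leNgt ltr_cos. Qed.

Lemma ler_sin : {in `[- (pi / 2), pi / 2] &, {mono (@sin R) : x y / x <= y}}.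
Proof. by move=> x y xI yI; rewrite !leNgt ltr_sin. Qed.

Lemma sin_MVT x : 0 <= x -> exists2 c, 0 <= c <= x & sin x = cos c * x.
Proof.
move=> x0; have [|c cI] := @MVT_segment R sin cos 0 x x0 (fun t _ => is_derive_sin t).
  by apply: continuous_subspaceT => t; exact: continuous_sin.
by rewrite sin0 !subr0 => ->; exists c.
Qed.

Lemma sin_le x : 0 <= x -> sin x <= x.
Proof.
by move=> x0; have [c _ ->] := sin_MVT x0; rewrite ler_piMl// cos_le1.
Qed.

Lemma sqr_sin_le x : sin x ^+ 2 <= x ^+ 2.
Proof.
wlog x0 : x / 0 <= x => [H|].
  have [/H//|x0] := leP 0 x.
  by rewrite -[sin x ^+ 2]sqrrN -sinN -[x ^+ 2]sqrrN H// oppr_ge0 ltW.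
have [x1|/ltW x1] := leP x 1.
  rewrite lerXn2r ?nnegrE ?sin_le// sin_ge0_pi// x0 (le_trans x1)//.
  by rewrite (le_trans _ (pi_ge2 R))// ler1n.
by rewrite sin2cos2 (@le_trans _ _ 1)// ?gerBl ?sqr_ge0// expr_ge1.
Qed.

(** Squared form of x cos (x / 2) <= 2 sin (x / 2): on the unit circle, an arc x
    exceeds its chord by a factor of at most 1 / cos (x / 2). *)
Lemma arc_le_chord x : 0 <= x <= pi ->
  x ^+ 2 * cos (x / 2) ^+ 2 <= 2 * (1 - cos x).
Proof.
move=> /andP[x0 xpi]; rewrite (cos_half x).
have x20 : 0 <= x / 2 by rewrite divr_ge0.
have [c /andP[c0 cx] ->] := sin_MVT x20.
have x2pi : x / 2 <= pi / 2 by rewrite ler_pM2r// invr_gt0.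
have pi2 : (pi : R) / 2 <= pi by rewrite ger_pMr ?pi_gt0// invf_le1 ?ler1n.
have cos0 : 0 <= cos (x / 2).
  by rewrite cos_ge0_pihalf// x2pi andbT (le_trans _ x20)// oppr_le0 (le_trans x20).
have cc : cos (x / 2) <= cos c.
  by rewrite ler_cos// in_itv/= ?c0 ?x20 ?(le_trans cx) ?(le_trans x2pi).
have : cos (x / 2) ^+ 2 <= cos c ^+ 2.
  by rewrite lerXn2r// nnegrE// (le_trans cos0).
have : 0 <= x ^+ 2 by exact: sqr_ge0.
by nra.
Qed.

Lemma acos_cos_le x t : -1 <= x <= 1 -> 0 <= t <= pi -> cos t <= x -> acos x <= t.
Proof.
move=> x1 tpi; rewrite -{1}(acosK (_ : x \in `[-1, 1]))// ler_cos//.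
by rewrite in_itv/= acos_ge0// acos_lepi.
Qed.

(** The left-hand side is 2 sin^2 (|x - y| / 2) and the right-hand side is
    2 sin ((x + y) / 2) sin (|x - y| / 2); with d = |x - y| / 2, the mean of x
    and y lies between d and pi - d, where the sine is at least sin d. *)
Lemma cosB_lower x y : 0 <= x <= pi -> 0 <= y <= pi ->
  1 - cos (x - y) <= `|cos x - cos y|.
Proof.
wlog xy : x y / y <= x => [H xI yI|].
  have [/H|/ltW/H] := leP y x; first exact.
  by rewrite distrC -cosN opprB; exact.
move=> /andP[x0 xpi] /andP[y0 ypi].
set s := (x + y) / 2; set d := (x - y) / 2.
have -> : cos x = cos (s + d) by congr cos; rewrite /s /d; lra.
have -> : cos y = cos (s - d) by congr cos; rewrite /s /d; lra.
rewrite (cos_half (x - y)) -/d cosD cosB.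
have d0 : 0 <= d by rewrite /d; lra.
have dpi : d <= pi / 2 by rewrite /d; lra.
have sd0 : 0 <= sin d by rewrite sin_ge0_pi// d0/=; have := pi_ge0 R; lra.
have sds : sin d <= sin s.
  have p0 := pi_ge0 R.
  have sinI t : 0 <= t <= pi / 2 -> t \in `[- (pi / 2), pi / 2].
    by rewrite in_itv/= => /andP[? ->]; rewrite andbT; lra.
  have [spi|spi] := leP s (pi / 2).
    by rewrite ler_sin ?sinI//; rewrite /s /d in d0 dpi spi *; lra.
  have -> : sin s = sin (pi - s) by rewrite sinB cospi sinpi; ring.
  by rewrite ler_sin ?sinI//; rewrite /s /d in d0 dpi spi *; lra.
rewrite (_ : (cos s * cos d - _) - _ = - (2 * (sin s * sin d))); last by ring.
rewrite normrN ger0_norm; last by rewrite mulr_ge0// mulr_ge0// (le_trans sd0).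
by nra.
Qed.

(** An explicit modulus of continuity, valid up to the endpoints, where the
    derivative of acos is infinite. *)
Lemma acos_uniform_continuous x y e : -1 <= x <= 1 -> -1 <= y <= 1 ->
  0 < e <= pi -> `|x - y| < 1 - cos e -> `|acos x - acos y| < e.
Proof.
move=> x1 y1 /andP[e0 epi] xye.
have xI : 0 <= acos x <= pi by rewrite acos_ge0// acos_lepi.
have yI : 0 <= acos y <= pi by rewrite acos_ge0// acos_lepi.
have := cosB_lower xI yI; rewrite !acosK// => /le_lt_trans/(_ xye).
rewrite ltrD2l ltrN2 -(cos_norm (acos x - _)) ltr_cos => [//||];
  rewrite in_itv/= ?normr_ge0 ?(ltW e0)//=.
by rewrite ler_norml; lra.
Qed.

End Trigonometry.

(** * Euclidean geometry and angles *)

Definition dot {R : realType} {m : nat} (u v : 'rV[R]_m) : R :=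
  \sum_(i < m) u 0 i * v 0 i.

Section Euclidean.
Variables (R : realType) (m : nat).
Implicit Types (u v w : 'rV[R]_m) (a : R).

Lemma dotC u v : dot u v = dot v u.
Proof. by apply: eq_bigr => i _; rewrite mulrC. Qed.

Lemma dotDl u v w : dot (u + v) w = dot u w + dot v w.
Proof. by rewrite -big_split; apply: eq_bigr => i _; rewrite mxE mulrDl. Qed.

Lemma dotZl a u v : dot (a *: u) v = a * dot u v.
Proof. by rewrite [RHS]mulr_sumr; apply: eq_bigr => i _; rewrite mxE mulrA. Qed.

Lemma dotNl u v : dot (- u) v = - dot u v.
Proof. by rewrite -scaleN1r dotZl mulN1r. Qed.

Lemma dotDr u v w : dot w (u + v) = dot w u + dot w v.
Proof. by rewrite dotC dotDl !(dotC w). Qed.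

Lemma dotZr a u v : dot v (a *: u) = a * dot v u.
Proof. by rewrite dotC dotZl (dotC v). Qed.

Lemma dotNr u v : dot v (- u) = - dot v u.
Proof. by rewrite dotC dotNl (dotC v). Qed.

Definition dotE := (dotDl, dotDr, dotNl, dotNr, dotZl, dotZr).

Lemma dotvv_ge0 u : 0 <= dot u u.
Proof. by apply: sumr_ge0 => i _; rewrite -expr2 sqr_ge0. Qed.

Lemma dotvv_eq0 u : dot u u = 0 -> u = 0.
Proof.
move=> /psumr_eq0P u0; apply/rowP => i; rewrite mxE; apply/eqP.
by rewrite -(sqrf_eq0 (u 0 i)) expr2 u0// => j _; rewrite -expr2 sqr_ge0.
Qed.

Lemma enormE u : enorm u = Num.sqrt (dot u u).
Proof. by congr Num.sqrt; apply: eq_bigr => i _; rewrite expr2. Qed.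

Lemma sqr_enorm u : enorm u ^+ 2 = dot u u.
Proof. by rewrite enormE sqr_sqrtr// dotvv_ge0. Qed.

Lemma enorm_ge0 u : 0 <= enorm u.
Proof. exact: sqrtr_ge0. Qed.

Lemma enormN u : enorm (- u) = enorm u.
Proof. by rewrite !enormE dotNl dotNr opprK. Qed.

Lemma enorm_le u a : 0 <= a -> dot u u <= a ^+ 2 -> enorm u <= a.
Proof.
by move=> a0; rewrite -sqr_enorm ler_pXn2r// nnegrE ?enorm_ge0.
Qed.

Lemma le_enorm u a : 0 <= a -> a ^+ 2 <= dot u u -> a <= enorm u.
Proof.
by move=> a0; rewrite -sqr_enorm ler_pXn2r// nnegrE ?enorm_ge0.
Qed.

Lemma coord_le_enorm u i : `|u 0 i| <= enorm u.
Proof.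
rewrite le_enorm// real_normK ?num_real// /dot (bigD1 i)//= -expr2 lerDl.
by apply: sumr_ge0 => j _; rewrite -expr2 sqr_ge0.
Qed.

Lemma cauchy_schwarz u v : dot u v ^+ 2 <= dot u u * dot v v.
Proof.
have [v0|v0] := eqVneq (dot v v) 0.
  by rewrite (dotvv_eq0 v0) -(scale0r 0) !dotZr !mul0r mulr0 expr0n.
have vp : 0 < dot v v by rewrite lt_neqAle eq_sym v0 dotvv_ge0.
have := dotvv_ge0 (dot v v *: u - dot u v *: v).
rewrite !dotE (dotC v u) [X in 0 <= X](_ : _ =
  dot v v * (dot u u * dot v v - dot u v ^+ 2)).
  by rewrite pmulr_rge0// subr_ge0.
by ring.
Qed.

End Euclidean.

Section Angle.
Variables (R : realType) (m : nat) (r : R).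
Hypothesis r0 : 0 < r.
Implicit Types x y z : 'rV[R]_m.

Definition on_sphere x := dot x x = r ^+ 2.
Definition cosangle x y := dot x y / r ^+ 2.
Definition angle x y := acos (cosangle x y).

Let r2 : 0 < r ^+ 2. Proof. by rewrite exprn_gt0. Qed.

Lemma cosangle_bound x y : on_sphere x -> on_sphere y ->
  -1 <= cosangle x y <= 1.
Proof.
move=> xr yr; rewrite -ler_norml normrM normfV (gtr0_norm r2) ler_pdivrMr//.
rewrite mul1r -(@ler_pXn2r _ 2)// ?nnegrE ?normr_ge0 ?(ltW r2)//.
by rewrite real_normK ?num_real// (le_trans (cauchy_schwarz _ _))// xr yr -expr2.
Qed.

Lemma angle_ge0 x y : on_sphere x -> on_sphere y -> 0 <= angle x y.
Proof. by move=> xr yr; rewrite acos_ge0// cosangle_bound. Qed.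

Lemma angle_lepi x y : on_sphere x -> on_sphere y -> angle x y <= pi.
Proof. by move=> xr yr; rewrite acos_lepi// cosangle_bound. Qed.

Lemma dot_angle x y : on_sphere x -> on_sphere y ->
  dot x y = r ^+ 2 * cos (angle x y).
Proof.
move=> xr yr; rewrite acosK; first by rewrite mulrC divfK// gt_eqF.
by rewrite in_itv/= cosangle_bound.
Qed.

Lemma angle_sym x y : angle x y = angle y x.
Proof. by rewrite /angle /cosangle dotC. Qed.

Lemma angle_xx x : on_sphere x -> angle x x = 0.
Proof. by move=> xr; rewrite /angle /cosangle xr divff ?gt_eqF// acos1. Qed.

Lemma chord2E x y : on_sphere x -> on_sphere y ->
  dot (x - y) (x - y) = 2 * r ^+ 2 * (1 - cos (angle x y)).
Proof.
by move=> xr yr; rewrite !dotE (dotC y x) xr yr dot_angle//; ring.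
Qed.

(** With p and q the components of x and z orthogonal to y, of lengths r sin a
    and r sin b, Cauchy-Schwarz for p and q says that the cosine of the angle
    between x and z is at least cos (a + b). *)
Lemma angle_triangle y x z : on_sphere x -> on_sphere y -> on_sphere z ->
  angle x z <= angle x y + angle y z.
Proof.
move=> xr yr zr; set a := angle x y; set b := angle y z.
have a0 : 0 <= a by exact: angle_ge0.
have b0 : 0 <= b by exact: angle_ge0.
have api : a <= pi by exact: angle_lepi.
have bpi : b <= pi by exact: angle_lepi.
have [abpi|/ltW abpi] := leP (a + b) pi; last first.
  by rewrite (le_trans _ abpi)// angle_lepi.
apply: acos_cos_le; rewrite ?cosangle_bound ?addr_ge0//.
rewrite /cosangle ler_pdivlMr// cosD.
have := cauchy_schwarz (x - cos a *: y) (z - cos b *: y).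
rewrite !dotE xr yr zr (dotC z y) (dotC y x) (dot_angle xr yr) (dot_angle yr zr) -/a -/b.
set t := dot x z.
have sa : 0 <= sin a by rewrite sin_ge0_pi// a0.
have sb : 0 <= sin b by rewrite sin_ge0_pi// b0.
rewrite [X in X ^+ 2 <= _](_ : _ = t - r ^+ 2 * (cos a * cos b)); last by ring.
rewrite [X in _ <= X](_ : _ = (r ^+ 2 * (sin a * sin b)) ^+ 2); last first.
  rewrite [RHS](_ : _ = r ^+ 4 * (sin a ^+ 2 * sin b ^+ 2)); last by ring.
  by rewrite !sin2cos2; ring.
rewrite -ler_sqrt ?sqr_ge0// !sqrtr_sqr => /ler_normlP[+ _].
rewrite (ger0_norm (mulr_ge0 (ltW r2) (mulr_ge0 sa sb))).
by lra.
Qed.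

Lemma enorm_le_angle x y : on_sphere x -> on_sphere y ->
  enorm (x - y) <= r * angle x y.
Proof.
move=> xr yr; apply: enorm_le.
  by rewrite mulr_ge0 ?(ltW r0)// angle_ge0.
rewrite chord2E// exprMn cos_half.
have := sqr_sin_le (angle x y / 2).
by rewrite exprMn; nra.
Qed.

(** By [arc_le_chord], it suffices that the cosine of half the angle exceed c, that
    is, that the angle be smaller than 2 acos c. *)
Lemma angle_le_enorm (c : R) : 0 <= c < 1 -> exists2 d : R, 0 < d &
  forall x y, on_sphere x -> on_sphere y -> enorm (x - y) < d ->
    c * (r * angle x y) <= enorm (x - y).
Proof.
move=> /andP[c0 c1].
have cI : -1 <= c <= 1 by rewrite (ltW c1) andbT (le_trans _ c0)// lerN10.
pose e := acos c.
have cI' : c \in `[-1, 1] by rewrite in_itv.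
have e0 : 0 < e by rewrite acos_gt0// c1 andbT; case/andP: cI.
have epi : e <= pi / 2.
  apply: acos_cos_le => //; last by rewrite cos_pihalf.
  by have := pi_ge0 R; lra.
have ce : cos e < 1.
  by rewrite acosK.
exists (r * Num.sqrt (2 * (1 - cos (2 * e)))).
  rewrite mulr_gt0// sqrtr_gt0 mulr_gt0// cos_half.
  rewrite (_ : 2 * e / 2 = e); last by field.
  have : 0 < sin e by rewrite sin_gt0_pi// e0/= (le_lt_trans epi)//; have := pi_gt0 R; lra.
  by move/(exprn_gt0 2); lra.
move=> x y xr yr xyd.
have a0 := angle_ge0 xr yr; have api := angle_lepi xr yr.
have ae : angle x y < 2 * e.
  rewrite ltNge; apply/negP => ea.
  move: xyd; rewrite ltNge => /negP; apply; apply: le_enorm.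
    by rewrite mulr_ge0 ?sqrtr_ge0// ltW.
  have cae : cos (angle x y) <= cos (2 * e).
    by rewrite ler_cos; [exact: ea|rewrite in_itv/=..]; lra.
  rewrite chord2E// exprMn sqr_sqrtr; first by nra.
  by have := cos_le1 (2 * e); lra.
apply: le_enorm; first by rewrite !mulr_ge0// ltW.
rewrite chord2E//.
rewrite (_ : 2 * r ^+ 2 * _ = r ^+ 2 * (2 * (1 - cos (angle x y)))); last by ring.
rewrite (_ : _ ^+ 2 = r ^+ 2 * (angle x y ^+ 2 * c ^+ 2)); last by ring.
rewrite ler_pM2l ?exprn_gt0//; apply: le_trans (arc_le_chord _); last by rewrite a0.
rewrite ler_wpM2l ?sqr_ge0// ler_pXn2r ?nnegrE//; last first.
  by rewrite cos_ge0_pihalf//; lra.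
by rewrite -(acosK cI') -/e ler_cos; [|rewrite in_itv/=..]; lra.
Qed.

(** With [enorm_le_angle]: arcs and chords define the same topology. *)
Lemma angle_lt (e : R) : 0 < e -> exists2 d : R, 0 < d &
  forall x y, on_sphere x -> on_sphere y -> enorm (x - y) < d ->
    r * angle x y < e.
Proof.
move=> e0; have [|d d0 H] := @angle_le_enorm (1 / 2); first by lra.
exists (Num.min d (e / 2)); first by rewrite lt_min d0 divr_gt0.
move=> x y xr yr; rewrite lt_min => /andP[xyd xye].
by have := H x y xr yr xyd; lra.
Qed.

End Angle.

(** * The intrinsic distance on the sphere *)

Section Polygons.
Variables (R : realType) (m : nat).
Implicit Types (g : R -> 'rV[R]_m) (s : seq R) (a b u : R).

Lemma polygon_length_nil a b g : polygon_length a b g [::] = 0.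
Proof. by rewrite /polygon_length big_geq. Qed.

Lemma polygon_length_cons a b u g s :
  polygon_length a b g (u :: s) = enorm (g u - g a) + polygon_length u b g s.
Proof. by rewrite /polygon_length /= big_nat_recl. Qed.

Lemma polygon_length_rcons a b u g s :
  polygon_length a b g (rcons s u) =
  polygon_length a b g s + enorm (g u - g (last a s)).
Proof.
elim: s a => [|v s IH] a /=.
  by rewrite polygon_length_cons !polygon_length_nil add0r addr0.
by rewrite !polygon_length_cons IH addrA.
Qed.

Lemma polygon_length_lipschitz (k : R) g :
    (forall t u, enorm (g u - g t) <= k * `|u - t|) ->
  forall a b s, path <%R a s -> polygon_length a b g s <= k * (last a s - a).
Proof.
move=> gk a b s; elim: s a => [|u s IH] a /=.
  by move=> _; rewrite polygon_length_nil subrr mulr0.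
move=> /andP[au us]; rewrite polygon_length_cons.
have -> : k * (last u s - a) = k * (u - a) + k * (last u s - u) by ring.
by rewrite lerD ?IH// (le_trans (gk _ _))// gtr0_norm ?subr_gt0.
Qed.

End Polygons.

Lemma enorm_lt_coord (R : realType) (m : nat) (d : R) : 0 < d ->
  exists2 e : R, 0 < e &
    forall u : 'rV[R]_m, (forall i, `|u 0 i| < e) -> enorm u < d.
Proof.
move=> d0; exists (d / m.+1%:R) => [|u ue]; first by rewrite divr_gt0.
apply: (@le_lt_trans _ _ (d * (m%:R / m.+1%:R))).
  apply: enorm_le; first by rewrite mulr_ge0 ?divr_ge0 ?(ltW d0).
  apply: (@le_trans _ _ (\sum_(i < m) (d / m.+1%:R) ^+ 2)).
    apply: ler_sum => i _; rewrite -expr2 -[u 0 i ^+ 2]real_normK ?num_real//.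
    by rewrite ler_pXn2r ?nnegrE ?divr_ge0 ?(ltW d0)// ltW.
  rewrite sumr_const card_ord mulrCA [leRHS]exprMn -[leLHS]mulr_natl.
  rewrite ler_wpM2r ?sqr_ge0// -natrX ler_nat.
  by case: (m) => // k; rewrite leq_pmulr.
rewrite gtr_pMr// ltr_pdivrMr// mul1r ltr_nat//.
Qed.

Section PathLowerBound.
Variables (R : realType) (m : nat) (r : R) (g : R -> 'rV[R]_m).
Hypotheses (r0 : 0 < r) (gr : forall t, on_sphere r (g t)).
Hypothesis gc : {within `[0, 1], continuous g}.

Let g_near (t d : R) : 0 <= t <= 1 -> 0 < d -> exists2 e : R, 0 < e &
  forall s : R, 0 <= s <= 1 -> `|s - t| < e -> enorm (g s - g t) < d.
Proof.
move=> t01 d0; have [e e0 ed] := @enorm_lt_coord R m d d0.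
have tA : `[0, 1]%classic t by rewrite /= in_itv.
have /subspace_continuousP/(_ t tA) := gc.
move=> /(_ _ (nbhsx_ballx (g t) e e0))/nbhs_ballP[h h0 hB].
exists h => // s s01 sth; apply: ed => i.
have [_ /(_ 0 i)] : ball (g t) e (g s).
  by apply: hB; [rewrite -ball_normE /= distrC | rewrite /= in_itv].
by rewrite -ball_normE /= !mxE distrC.
Qed.

(** The polygons inscribed in the path between 0 and u that have almost the
    length of the spherical arc from g 0 to g u can be extended as long as the
    chords remain short, which continuity at the supremum of the reachable u
    allows up to u = 1. *)
Lemma polygon_near_angle (c : R) : 0 <= c < 1 ->
  exists2 s : seq R, itv_partition 0 1 s &
    c * (r * angle r (g 0) (g 1)) <= polygon_length 0 1 g s.
Proof.
move=> c01; have [d d0 dP] := angle_le_enorm m r0 c01.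
pose P u := exists2 s : seq R, path <%R 0 s /\ last 0 s = u &
  c * (r * angle r (g 0) (g u)) <= polygon_length 0 1 g s.
have P0 : P 0.
  by exists [::] => //; rewrite angle_xx// polygon_length_nil !mulr0.
have PS u v : P u -> u < v -> enorm (g v - g u) < d -> P v.
  move=> [s [sp <-] us] uv ud; exists (rcons s v).
    by rewrite rcons_path last_rcons sp.
  rewrite polygon_length_rcons; apply: le_trans (lerD us (dP _ _ _ _ ud)) => //.
  rewrite -!mulrDr (angle_sym r (g v)) !ler_wpM2l ?(ltW r0)//; last exact: angle_triangle.
  by case/andP: c01.
pose A := [set u : R | 0 <= u <= 1 /\ P u].
have A0 : A 0 by split; rewrite ?lexx ?ler01.
have A_ub : has_ubound A by exists 1 => u [/andP[]].
have supA : has_sup A by split; [exists 0|].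
pose t := sup A.
have t0 : 0 <= t by apply: ub_le_sup.
have t1 : t <= 1 by apply: ge_sup; [exists 0|move=> u [/andP[]]].
have [e e0 eP] : exists2 e : R, 0 < e & forall s : R, 0 <= s <= 1 ->
    `|s - t| < e -> enorm (g s - g t) < d.
  by apply: g_near; rewrite ?t0.
have Pt : P t.
  have [u [u01 Pu] ut] := sup_adherent e0 supA.
  have : u <= t by apply: ub_le_sup.
  rewrite le_eqVlt => /predU1P[<-//|utt]; apply: (PS _ _ Pu utt).
  rewrite -enormN opprB; apply: eP => //.
  by rewrite ltr_norml; rewrite -/t in ut; lra.
suff t1E : t = 1.
  by case: Pt => s [sp sl]; rewrite t1E in sl *; exists s => //; split=> //; rewrite sl.
apply/eqP; move: t1; rewrite le_eqVlt => /predU1P[->//|t1].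
pose v := Num.min 1 (t + e / 2).
have tv : t < v by rewrite lt_min t1/= ltrDl divr_gt0.
have v01 : 0 <= v <= 1 by rewrite ge_min lexx/= andbT ltW// (le_lt_trans t0).
have vte : v <= t + e / 2 by rewrite ge_min lexx orbT.
have : v <= t.
  apply: ub_le_sup => //; split=> //; apply: (PS _ _ Pt tv).
  by apply: eP => //; rewrite ltr_norml; lra.
by rewrite leNgt tv.
Qed.

Lemma path_length_ge_angle : ((r * angle r (g 0) (g 1))%:E <= path_length 0 1 g)%E.
Proof.
(* The factor a / (e + a) < 1 loses at most e of the arc length a. *)
apply/lee_addgt0Pr => e e0; set a := r * _.
have a0 : 0 <= a by rewrite mulr_ge0 ?angle_ge0// ltW.
have ae : 0 < e + a by rewrite ltr_wpDr.
have [|s sp sl] := @polygon_near_angle (a / (e + a)).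
  by rewrite divr_ge0 ?(ltW ae)//= ltr_pdivrMr// mul1r ltrDr.
apply: (@le_trans _ _ ((polygon_length 0 1 g s)%:E + e%:E)%E); last first.
  by rewrite leeD2r//; apply: ereal_sup_ubound; exists s.
rewrite -EFinD lee_fin (le_trans _ (lerD sl (lexx e)))// -/a.
have ca : a / (e + a) * (e + a) = a by rewrite divfK// gt_eqF.
have c1 : a / (e + a) <= 1 by rewrite ler_pdivrMr// mul1r lerDr ltW.
by nra.
Qed.

End PathLowerBound.

Section GreatCircles.
Variables (R : realType) (m : nat) (r : R).
Hypothesis r0 : 0 < r.
Implicit Types x y u : 'rV[R]_m.

Lemma dot_delta x i : dot x (delta_mx 0 i) = x 0 i.
Proof.
rewrite /dot (bigD1 i)//= big1 => [|j /negPf ji]; last by rewrite mxE ji andbF mulr0.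
by rewrite mxE !eqxx mulr1 addr0.
Qed.

(** Two axes are needed: on S^0, antipodal points are not joined by a path. *)
Lemma exists_orthogonal (i j : 'I_m) x : i != j ->
  exists2 u, on_sphere r u & dot x u = 0.
Proof.
move=> ij; suff [v v0 xv] : exists2 v, v != 0 & dot x v = 0.
  exists ((r / enorm v) *: v); last by rewrite dotZr xv mulr0.
  have nv0 : enorm v != 0.
    apply: contra_neq v0 => nv; apply: dotvv_eq0.
    by rewrite -sqr_enorm nv expr0n.
  by rewrite /on_sphere dotZl dotZr -sqr_enorm; field.
have [/eqP xi|xi] := boolP (x 0 i == 0).
  exists (delta_mx 0 i); last by rewrite dot_delta.
  by apply/eqP => /matrixP/(_ 0 i)/eqP; rewrite !mxE !eqxx oner_eq0.
exists (x 0 i *: delta_mx 0 j - x 0 j *: delta_mx 0 i); last first.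
  by rewrite !dotE !dot_delta mulrC subrr.
apply/eqP => /matrixP/(_ 0 j)/eqP; rewrite !mxE !eqxx (eq_sym j) (negPf ij).
by rewrite mulr0 subr0 mulr1 (negPf xi).
Qed.

(** y is the end of an arc of the great circle through x in a direction u; u is
    arbitrary when y = x or y = - x. *)
Lemma great_circle_through (i j : 'I_m) x y : i != j ->
  on_sphere r x -> on_sphere r y ->
  exists u, [/\ on_sphere r u, dot x u = 0 &
    y = cos (angle r x y) *: x + sin (angle r x y) *: u].
Proof.
move=> ij xr yr; set a := angle r x y.
have yx : dot (y - cos a *: x) (y - cos a *: x) = r ^+ 2 * sin a ^+ 2.
  by rewrite !dotE xr yr (dotC y x) (dot_angle r0 xr yr) -/a sin2cos2; ring.
have [sa|sa] := eqVneq (sin a) 0.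
  have [u ur xu] := exists_orthogonal x ij; exists u; split=> //.
  rewrite sa scale0r addr0; apply/eqP; rewrite -subr_eq0; apply/eqP.
  by apply: dotvv_eq0; rewrite yx sa expr0n mulr0.
exists ((sin a)^-1 *: (y - cos a *: x)); split.
- by rewrite /on_sphere dotZl dotZr yx; field.
- by rewrite !dotE xr (dot_angle r0 xr yr) -/a; ring.
- by rewrite scalerA divff// scale1r addrC subrK.
Qed.

Definition great_circle x u (a t : R) := cos (t * a) *: x + sin (t * a) *: u.

Lemma great_circle_on_sphere x u a t : on_sphere r x -> on_sphere r u ->
  dot x u = 0 -> on_sphere r (great_circle x u a t).
Proof.
move=> xr ur xu; rewrite /on_sphere /great_circle !dotE xr ur (dotC u x) xu.
by rewrite -[RHS]mul1r -(cos2Dsin2 (t * a)); ring.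
Qed.

Lemma great_circle_lipschitz x u a s t : on_sphere r x -> on_sphere r u ->
  dot x u = 0 -> 0 <= a ->
  enorm (great_circle x u a t - great_circle x u a s) <= (r * a) * `|t - s|.
Proof.
move=> xr ur xu a0.
apply: enorm_le; first by rewrite !mulr_ge0// ltW.
rewrite [leLHS](_ : _ = 2 * r ^+ 2 * (1 - cos ((t - s) * a))); last first.
  rewrite mulrBl cosB /great_circle !dotE xr ur (dotC u x) xu.
  rewrite [LHS](_ : _ = r ^+ 2 * ((cos (t * a) ^+ 2 + sin (t * a) ^+ 2) +
    (cos (s * a) ^+ 2 + sin (s * a) ^+ 2)
    - 2 * (cos (t * a) * cos (s * a) + sin (t * a) * sin (s * a)))); last by ring.
  by rewrite !cos2Dsin2; ring.
rewrite cos_half exprMn real_normK ?num_real//.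
rewrite (_ : 2 * r ^+ 2 * _ = 4 * r ^+ 2 * sin ((t - s) * a / 2) ^+ 2); last by ring.
rewrite (_ : (r * a) ^+ 2 * _ = 4 * r ^+ 2 * ((t - s) * a / 2) ^+ 2); last by field.
by rewrite ler_wpM2l ?sqr_sin_le// mulr_ge0// sqr_ge0.
Qed.

Lemma great_circle_continuous x u a : continuous (great_circle x u a).
Proof.
move=> t; apply: cvgD; apply: cvgZr_tmp.
  by apply: continuous_comp; [exact: mulrr_continuous|exact: continuous_cos].
by apply: continuous_comp; [exact: mulrr_continuous|exact: continuous_sin].
Qed.

End GreatCircles.

Section SphereDistance.
Variables (R : realType) (n : nat) (r : {posnum R}).

Lemma on_sphereE (x : 'rV[R]_n.+1) : on_sphere r%:num x <-> enorm x == r%:num.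
Proof.
rewrite /on_sphere -sqr_enorm; split=> [/eqP|/eqP->//].
by rewrite eqrXn2// ?enorm_ge0.
Qed.

Lemma sval_on_sphere (x : sphere n r) : on_sphere r%:num (sval x).
Proof. by apply/on_sphereE; exact: svalP x. Qed.

(** The infimum is attained by an arc of a great circle. *)
Theorem sphere_distE (x y : sphere n r) : (0 < n)%N ->
  sphere_dist x y = r%:num * angle r%:num (sval x) (sval y).
Proof.
move=> n0; pose i : 'I_n.+1 := ord0; pose j : 'I_n.+1 := ord_max.
have ij : i != j by rewrite -val_eqE/= eq_sym -lt0n.
have r0 : 0 < r%:num by [].
have [xr yr] := (sval_on_sphere x, sval_on_sphere y).
have [u [ur xu yE]] := great_circle_through r0 ij xr yr.
set a := angle _ _ _ in yE *.
rewrite /sphere_dist; suff -> : ereal_inf [set path_length 0 1 (fun t => sval (g t))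
    | g in sphere_path x y] = (r%:num * a)%:E by [].
pose h t : 'rV[R]_n.+1 := great_circle (sval x) u a t.
have hr t : on_sphere r%:num (h t) by exact: great_circle_on_sphere.
pose g t : sphere n r := exist _ (h t) ((on_sphereE _).1 (hr t)).
apply/eqP; rewrite eq_le; apply/andP; split.
- apply: (@le_trans _ _ (path_length 0 1 h)).
    apply: ereal_inf_lbound; exists g => //; split.
    + by apply: continuous_subspaceT; exact: great_circle_continuous.
    + by apply: val_inj; rewrite /= /h /great_circle mul0r cos0 sin0 scale1r scale0r addr0.
    + by apply: val_inj; rewrite /= /h /great_circle mul1r -yE.
  apply: ge_ereal_sup => _ [s [sp /eqP sl] <-]; rewrite lee_fin.
  have hL t v : enorm (h v - h t) <= (r%:num * a) * `|v - t|.
    by apply: great_circle_lipschitz; rewrite ?angle_ge0.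
  by have := polygon_length_lipschitz hL 1 sp; rewrite sl subr0 mulr1.
- apply: le_ereal_inf_tmp => _ [f [fc f0 f1] <-].
  rewrite /a -f0 -f1; apply: (@path_length_ge_angle _ _ _ (fun t => sval (f t))) => //.
  by move=> t; exact: sval_on_sphere.
Qed.

End SphereDistance.

(** * Uniform approximation by polynomials *)

Section Bernstein.
Variable R : realType.
Implicit Types (g h : nat -> R) (x a b c : R).

(** The polynomial \sum_(k <= n) 'C(n, k) g(k) x^k (1 - x)^(n - k), that is, the
    expectation of g for the number of successes in n trials of probability x;
    the recursion is on the outcome of the first trial. *)
Fixpoint bernstein n g : {poly R} :=
  if n is n'.+1 then
    'X * bernstein n' (g \o S) + (1 - 'X) * bernstein n' g
  else (g 0)%:P.

Lemma bernsteinS n g x : (bernstein n.+1 g).[x] =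
  x * (bernstein n (g \o S)).[x] + (1 - x) * (bernstein n g).[x].
Proof. by rewrite /= !hornerE. Qed.

Lemma le_bernstein n g h x : 0 <= x <= 1 ->
  (forall k, (k <= n)%N -> g k <= h k) -> (bernstein n g).[x] <= (bernstein n h).[x].
Proof.
move=> /andP[x0 x1]; elim: n g h => [|n IH] g h gh.
  by rewrite /= !hornerE gh.
rewrite !bernsteinS lerD// ler_wpM2l ?subr_ge0// IH// => k kn.
  exact: gh.
by apply: gh; rewrite leqW.
Qed.

(** Mean and variance of the binomial distribution. *)
Lemma bernstein_sqr n a b c x :
  (bernstein n (fun k => a + b * (k%:R - c) ^+ 2)).[x] =
  a + b * (n%:R * x * (1 - x) + (n%:R * x - c) ^+ 2).
Proof.
elim: n c => [|n IH] c; first by rewrite /= !hornerE; ring.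
rewrite bernsteinS IH.
rewrite (_ : _ \o S = fun k => a + b * (k%:R - (c - 1)) ^+ 2); last first.
  by apply/funext => k /=; rewrite -natr1; ring.
by rewrite IH -natr1; ring.
Qed.

(** Chebyshev's inequality: the mean of f (k / n) differs from f x by e / 2, for
    the nodes k / n close to x, plus a multiple of the variance. *)
Lemma bernstein_approximation (f : R -> R) (M : R) :
  (forall x, 0 <= x <= 1 -> `|f x| <= M) ->
  (forall e : R, 0 < e -> exists2 d : R, 0 < d & forall x y : R, 0 <= x <= 1 ->
     0 <= y <= 1 -> `|x - y| < d -> `|f x - f y| < e) ->
  forall e : R, 0 < e -> exists p : {poly R},
    forall x, 0 <= x <= 1 -> `|f x - p.[x]| <= e.
Proof.
move=> fM fc e e0; have [|d d0 fd] := fc (e / 2); first by rewrite divr_gt0.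
have M0 : 0 <= M by rewrite (le_trans _ (fM 0 _))// lexx ler01.
pose B := 2 * M / d ^+ 2.
have B0 : 0 <= B by rewrite !mulr_ge0// invr_ge0 sqr_ge0.
pose n := (Num.trunc (2 * B / e)).+1.
have n0 : 0 < n%:R :> R by rewrite ltr0n.
have nB : B / n%:R <= e / 2.
  have : 2 * B / e < n%:R by exact: truncnS_gt.
  by rewrite ltr_pdivrMr// ler_pdivrMr//; lra.
exists (bernstein n (fun k => f (k%:R / n%:R))) => x x01.
have fB k : (k <= n)%N ->
    `|f x - f (k%:R / n%:R)| <= e / 2 + B / n%:R ^+ 2 * (k%:R - n%:R * x) ^+ 2.
  move=> kn; have k01 : 0 <= (k%:R / n%:R : R) <= 1.
    by rewrite divr_ge0//= ler_pdivrMr// mul1r ler_nat.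
  have -> : B / n%:R ^+ 2 * (k%:R - n%:R * x) ^+ 2 = B * (x - k%:R / n%:R) ^+ 2.
    by field; rewrite gt_eqF.
  have [xk|dxk] := ltP `|x - k%:R / n%:R| d.
    by rewrite (le_trans (ltW (fd _ _ x01 k01 xk)))// lerDl mulr_ge0// sqr_ge0.
  rewrite (@le_trans _ _ (2 * M))//.
    rewrite (le_trans (ler_normB _ _))// mulrDl !mul1r lerD//; exact: fM.
  rewrite ler_wpDl ?divr_ge0 ?(ltW e0)// -[_ ^+ 2]real_normK ?num_real//.
  rewrite /B -mulrA ler_peMr ?mulr_ge0// mulrC ler_pdivlMr ?exprn_gt0// mul1r.
  by rewrite ler_pXn2r ?nnegrE// ltW.
have Ex : e / 2 + B / n%:R ^+ 2 * (n%:R * x * (1 - x) + (n%:R * x - n%:R * x) ^+ 2) <= e.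
  rewrite (_ : B / _ * _ = B / n%:R * (x * (1 - x))); last by field; rewrite gt_eqF.
  have [B'0 xx] : 0 <= B / n%:R /\ x * (1 - x) <= 1.
    by split; [rewrite divr_ge0// ltW|case/andP: x01; nra].
  rewrite [leRHS]splitr lerD2l (le_trans _ nB)//.
  by rewrite ler_piMr.
rewrite distrC ler_norml; apply/andP; split.
- rewrite lerBrDl.
  apply: (@le_trans _ _ (bernstein n (fun k => (f x - e / 2) +
      - (B / n%:R ^+ 2) * (k%:R - n%:R * x) ^+ 2)).[x]).
    by rewrite bernstein_sqr; lra.
  by apply: le_bernstein => // k /fB; rewrite ler_norml; lra.
- rewrite lerBlDl.
  apply: (@le_trans _ _ (bernstein n (fun k => (f x + e / 2) +
      (B / n%:R ^+ 2) * (k%:R - n%:R * x) ^+ 2)).[x]).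
    by apply: le_bernstein => // k /fB; rewrite ler_norml; lra.
  by rewrite bernstein_sqr; lra.
Qed.

(** The affine change of variable from [0, 1] to [-1, 1]. *)
Lemma weierstrass_approximation (f : R -> R) (M : R) :
  (forall x, -1 <= x <= 1 -> `|f x| <= M) ->
  (forall e : R, 0 < e -> exists2 d : R, 0 < d & forall x y : R, -1 <= x <= 1 ->
     -1 <= y <= 1 -> `|x - y| < d -> `|f x - f y| < e) ->
  forall e : R, 0 < e -> exists p : {poly R},
    forall x, -1 <= x <= 1 -> `|f x - p.[x]| <= e.
Proof.
move=> fM fc e e0; pose F x := f (2 * x - 1).
have FM x : 0 <= x <= 1 -> `|F x| <= M by move=> x01; apply: fM; lra.
have Fc (e' : R) : 0 < e' -> exists2 d : R, 0 < d & forall x y : R, 0 <= x <= 1 ->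
    0 <= y <= 1 -> `|x - y| < d -> `|F x - F y| < e'.
  move=> /fc[d d0 fd]; exists (d / 2); first by rewrite divr_gt0.
  move=> x y x01 y01 xy; apply: fd; [lra|lra|].
  rewrite (_ : _ - _ = 2 * (x - y)); last by ring.
  by rewrite normrM ger0_norm// mulrC -ltr_pdivlMr.
have [p pF] := bernstein_approximation FM Fc e0.
exists (p \Po (2^-1 *: ('X + 1))) => x x1.
rewrite horner_comp !hornerE (_ : f x = F (2^-1 * (x + 1))); last first.
  by rewrite /F; congr f; field.
by apply: pF; lra.
Qed.

End Bernstein.

(** * Integrals over half a period *)

Section TrigonometricIntegrals.
Variable R : realType.
Implicit Types (p q k n : nat) (r x : R).

Local Notation mu := (@lebesgue_measure R).

Definition integral0pi (f : R -> R) : R := \int[mu]_(x in `[0, pi]) f x.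

Lemma integral0pi_derive (F f : R -> R) : continuous f ->
  (forall x, is_derive x 1 F (f x)) -> integral0pi f = F pi - F 0.
Proof.
move=> cf dF.
have cF : continuous F by move=> x; apply/differentiable_continuous/derivable1_diffP.
rewrite /integral0pi /Rintegral (@continuous_FTC2 _ f F 0 pi)//.
- exact: pi_gt0.
- exact: continuous_subspaceT.
- split=> [x _|//|//].
  + exact: ex_derive.
  + by apply: cvg_at_right_filter; exact: cF.
  + by apply: cvg_at_left_filter; exact: cF.
- by move=> x _; rewrite derive1E derive_val.
Qed.

Lemma integrable0pi (f : R -> R) : continuous f ->
  mu.-integrable `[0, pi] (EFin \o f).
Proof.
move=> cf; apply: continuous_compact_integrable; first exact: segment_compact.
exact: continuous_subspaceT.
Qed.

Lemma integral0piD (f g : R -> R) : continuous f -> continuous g ->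
  integral0pi (fun x => f x + g x) = integral0pi f + integral0pi g.
Proof. by move=> cf cg; rewrite /integral0pi RintegralD//; exact: integrable0pi. Qed.

Lemma integral0piZ (a : R) (f : R -> R) : continuous f ->
  integral0pi (fun x => a * f x) = a * integral0pi f.
Proof. by move=> cf; rewrite /integral0pi RintegralZl//; exact: integrable0pi. Qed.

Definition cos_sin p q x := cos x ^+ p * sin x ^+ q.

Lemma continuousX (f : R -> R) n : continuous f -> continuous (fun x => f x ^+ n).
Proof.
move=> cf x; apply: (@continuous_comp _ _ _ f (fun y => y ^+ n)); first exact: cf.
exact: exprn_continuous.
Qed.

Lemma continuousZ (f : R -> R) (a : R) : continuous f -> continuous (fun x => a * f x).
Proof. by move=> cf x; apply: cvgM; [exact: cvg_cst|exact: cf]. Qed.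

Lemma continuous_cos_sin p q : continuous (cos_sin p q).
Proof.
move=> x; apply: cvgM; apply: continuousX; [exact: continuous_cos|exact: continuous_sin].
Qed.

(** For p even, the value of Euler's beta function at (p + 1) / 2 and (q + 1) / 2. *)
Definition beta_trig p q : R := integral0pi (cos_sin p q).

(** Integration of the derivative of cos^(p + 1) sin^(q + 1), which vanishes at
    both ends. *)
Lemma beta_trig_parts p q :
  p.+1%:R * beta_trig p q.+2 = q.+1%:R * beta_trig p.+2 q.
Proof.
pose C := @continuous_cos_sin.
apply/eqP; rewrite eq_sym -subr_eq0 -mulNr -!integral0piZ -?integral0piD//;
  try exact: C; try exact/continuousZ/C.
apply/eqP; pose F : R -> R := cos ^+ p.+1 * sin ^+ q.+1.
transitivity (F pi - F 0); last by rewrite /F !fctE sinpi sin0 !expr0n !mulr0 subrr.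
apply: integral0pi_derive => x.
  by apply: cvgD; apply: continuousZ; exact: C.
rewrite /F; apply: is_derive_eq; rewrite /cos_sin !fctE /GRing.scale /=.
by rewrite !exprS; ring.
Qed.

Lemma beta_trig_pythagoras p q :
  beta_trig p q = beta_trig p.+2 q + beta_trig p q.+2.
Proof.
rewrite /beta_trig -integral0piD; [|exact: continuous_cos_sin..].
apply: eq_Rintegral => x _; rewrite /cos_sin.
rewrite -[LHS]mulr1 -(cos2Dsin2 x) !exprS; ring.
Qed.

Lemma beta_trigSSl p q :
  (p + q).+2%:R * beta_trig p.+2 q = p.+1%:R * beta_trig p q.
Proof.
rewrite (beta_trig_pythagoras p q) mulrDr beta_trig_parts.
by rewrite -mulrDl -natrD addSn addnS.
Qed.

Lemma beta_trigSSr p q :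
  (p + q).+2%:R * beta_trig p q.+2 = q.+1%:R * beta_trig p q.
Proof.
rewrite (beta_trig_pythagoras p q) mulrDr -beta_trig_parts.
by rewrite -mulrDl -natrD addSn addnS addnC.
Qed.

Lemma beta_trig_odd p q : odd p -> beta_trig p q = 0.
Proof.
elim/ltn_ind: p q => -[//|[|p]] IH q.
  move=> _; pose F : R -> R := q.+1%:R^-1 \*: sin ^+ q.+1.
  transitivity (F pi - F 0).
    apply: integral0pi_derive; first exact: continuous_cos_sin.
    move=> x; rewrite /F; apply: is_derive_eq; rewrite /cos_sin /GRing.scale /= ?fctE expr1.
    by rewrite -mulrA mulKf ?pnatr_eq0// mulrC.
  by rewrite /F /= !fctE sinpi sin0 !expr0n !scaler0 subrr.
rewrite /= negbK => op; have := beta_trigSSl p q; rewrite (IH p)// mulr0 => /eqP.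
by rewrite mulf_eq0 pnatr_eq0 /= => /eqP.
Qed.

Lemma beta_trig00 : beta_trig 0 0 = pi.
Proof.
rewrite /beta_trig (_ : cos_sin 0 0 = fun=> 1).
  by rewrite (@integral0pi_derive id) ?subr0// => x; exact: cvg_cst.
by apply/funext => x; rewrite /cos_sin !expr0 mulr1.
Qed.

Lemma beta_trig01 : beta_trig 0 1 = 2.
Proof.
pose F : R -> R := - cos.
transitivity (F pi - F 0); last by rewrite /F !fctE cospi cos0; ring.
apply: integral0pi_derive; first exact: continuous_cos_sin.
by move=> x; rewrite /F; apply: is_derive_eq; rewrite /cos_sin expr0 expr1; ring.
Qed.

Lemma beta_trig_gt0 q : 0 < beta_trig 0 q.
Proof.
elim/ltn_ind: q => -[|[|q]] IH; rewrite ?beta_trig00 ?beta_trig01 ?pi_gt0//.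
have : 0 < q.+1%:R * beta_trig 0 q by rewrite mulr_gt0// IH// ltnW.
by rewrite -(beta_trigSSr 0 q) pmulr_rgt0.
Qed.

(** Up to normalisation, the potential of the uniform measure on the sphere
    S^(k + 1) of radius r. *)
Definition exp_sin r k : R := integral0pi (fun x => expR (- (r * x)) * sin x ^+ k).

Lemma continuous_exp_sin r k : continuous (fun x => expR (- (r * x)) * sin x ^+ k).
Proof.
move=> x; apply: cvgM; last by apply: continuousX; exact: continuous_sin.
apply: (@continuous_comp _ _ _ (fun x => - (r * x)) expR); last exact: continuous_expR.
by apply: cvgN; apply: (@continuousZ id) => y; exact: cvg_id.
Qed.

(** Two integrations by parts in one: the primitive used below vanishes at both
    ends because of its factor sin^(k + 1). *)
Lemma exp_sinSS r k :
  (r ^+ 2 + k.+2%:R ^+ 2) * exp_sin r k.+2 = (k.+2 * k.+1)%:R * exp_sin r k.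
Proof.
pose c j x := expR (- (r * x)) * sin x ^+ j.
have cc j : continuous (c j) by exact: continuous_exp_sin.
apply/eqP; rewrite eq_sym -subr_eq0 -mulNr -!integral0piZ; [|exact: cc..].
rewrite -integral0piD; last 2 first.
- exact: (@continuousZ (c k) _ (cc k)).
- exact: (@continuousZ (c k.+2) _ (cc k.+2)).
apply/eqP; pose F : R -> R :=
  (expR \o ((- r) \*: id)) * (sin ^+ k.+1 * (r \*: sin + k.+2%:R \*: cos)).
transitivity (F pi - F 0); last first.
  by rewrite /F /= !fctE sinpi sin0 !expr0n /= !mul0r !mulr0 subrr.
apply: integral0pi_derive => x.
  apply: cvgD; [exact: (@continuousZ (c k) _ (cc k))|].
  exact: (@continuousZ (c k.+2) _ (cc k.+2)).
rewrite /F; apply: is_derive_eq; rewrite !fctE /c /= /GRing.scale /= !mulNr.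
set e := expR _; rewrite !exprS natrM; apply/eqP; rewrite -subr_eq0.
(* The primitive was chosen so that the two sides agree modulo cos^2 + sin^2 = 1. *)
rewrite [X in X == 0](_ : _ = e * sin x ^+ k * k.+2%:R * k.+1%:R *
  (cos x ^+ 2 - (1 - sin x ^+ 2))); last by ring.
by rewrite cos2sin2 subrr mulr0.
Qed.

Lemma exp_sin0 r : r != 0 -> exp_sin r 0 = (1 - expR (- (pi * r))) / r.
Proof.
move=> r0; pose F : R -> R := (- r^-1) \*: (expR \o ((- r) \*: id)).
transitivity (F pi - F 0).
  apply: integral0pi_derive; first exact: continuous_exp_sin.
  move=> x; rewrite /F; apply: is_derive_eq; rewrite /= /GRing.scale /= !mulNr expr0.
  by field.
rewrite /F /= /GRing.scale /= !mulNr mulr0 oppr0 expR0 (mulrC r pi). ring.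
Qed.

Lemma exp_sin1 r : exp_sin r 1 = (1 + expR (- (pi * r))) / (1 + r ^+ 2).
Proof.
have r1 : 1 + r ^+ 2 != 0 by rewrite gt_eqF// ltr_pwDl// sqr_ge0.
pose F : R -> R :=
  (- (1 + r ^+ 2)^-1) \*: ((expR \o ((- r) \*: id)) * (r \*: sin + cos)).
transitivity (F pi - F 0).
  apply: integral0pi_derive; first exact: continuous_exp_sin.
  move=> x; rewrite /F; apply: is_derive_eq; rewrite !fctE /= /GRing.scale /= !mulNr expr1.
  by field.
rewrite /F /= !fctE /= /GRing.scale /= !mulNr mulr0 oppr0 expR0 (mulrC r pi).
by rewrite sinpi sin0 cospi cos0; ring.
Qed.

Lemma exp_sin_gt0 r k : 0 < r -> 0 < exp_sin r k.
Proof.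
move=> r0; elim/ltn_ind: k => -[|[|k]] IH.
- rewrite exp_sin0 ?gt_eqF// divr_gt0// subr_gt0 -expR0 ltr_expR oppr_lt0.
  by rewrite mulr_gt0// pi_gt0.
- by rewrite exp_sin1 divr_gt0 ?addr_gt0 ?expR_gt0 ?exprn_gt0.
- have : 0 < (k.+2 * k.+1)%:R * exp_sin r k by rewrite mulr_gt0 ?ltr0n ?IH// ltnW.
  by rewrite -exp_sinSS pmulr_rgt0// addr_gt0 ?exprn_gt0.
Qed.

Lemma prod_skip (P : pred nat) (F : nat -> R) k : ~~ P k.+1 -> P k.+2 ->
  \prod_(1 <= j < k.+3 | P j) F j = \prod_(1 <= j < k.+1 | P j) F j * F k.+2.
Proof.
move=> /negPf P1 P2; rewrite big_mkcond big_nat_recr// big_nat_recr//= P1 P2 mulr1.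
by rewrite -big_mkcond.
Qed.

(** The total mass of the weight measure on S^(k + 1); it satisfies a two-step
    recursion because both integrals do. *)
Lemma beta_trig_exp_sin r k : 0 < r -> beta_trig 0 k / exp_sin r k =
  if odd k then
    2 * (\prod_(1 <= j < k.+1 | odd j) ((r / j%:R) ^+ 2 + 1))
      / (1 + expR (- (pi * r)))
  else
    pi * r * (\prod_(1 <= j < k.+1 | ~~ odd j) ((r / j%:R) ^+ 2 + 1))
      / (1 - expR (- (pi * r))).
Proof.
move=> r0; have rn0 : r != 0 by rewrite gt_eqF.
elim/ltn_ind: k => -[|[|k]] IH /=.
- by rewrite beta_trig00 exp_sin0// big_geq// mulr1 invf_div mulrA.
- by rewrite beta_trig01 exp_sin1 big_mkcond big_nat1 /= divr1 invf_div (addrC 1) mulrA.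
rewrite negbK; have := IH k; rewrite ltnW// => /(_ isT) {}IH.
transitivity (beta_trig 0 k / exp_sin r k * ((r / k.+2%:R) ^+ 2 + 1)); last first.
  rewrite IH; case: ifP => ok.
    by rewrite prod_skip/= ?ok//; ring.
  by rewrite (@prod_skip (fun j => ~~ odd j))/= ?ok//; ring.
have k1 : k.+1%:R != 0 :> R by rewrite pnatr_eq0.
have k2 : k.+2%:R != 0 :> R by rewrite pnatr_eq0.
have rk : r ^+ 2 + k.+2%:R ^+ 2 != 0 by rewrite gt_eqF// addr_gt0 ?exprn_gt0.
have -> : beta_trig 0 k.+2 = k.+1%:R * beta_trig 0 k / k.+2%:R.
  by rewrite -(beta_trigSSr 0 k) mulrAC divff// mul1r.
have -> : exp_sin r k.+2 = k.+2%:R * k.+1%:R * exp_sin r k / (r ^+ 2 + k.+2%:R ^+ 2).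
  by rewrite -natrM -exp_sinSS mulrAC divff// mul1r.
have e0 : exp_sin r k != 0 by rewrite gt_eqF// exp_sin_gt0.
move: k1 k2 rk e0; move: (k.+1%:R : R) (k.+2%:R : R) (exp_sin r k) => a c e a0 c0 rc e0.
by field; rewrite a0 c0 rc e0.
Qed.

End TrigonometricIntegrals.

(** * Means of bounded functions *)

Section BoundedMeasurable.
Context d (T : measurableType d) (R : realType).
Implicit Types f g : T -> R.

(** A class of functions closed under the ring operations and integrable for
    every probability measure. *)
Definition bounded_measurable f :=
  measurable_fun [set: T] f /\ exists M : R, forall t, `|f t| <= M.

Lemma bounded_measurable_cst a : bounded_measurable (fun=> a).
Proof. by split; [exact: measurable_cst|exists `|a|]. Qed.

Lemma bounded_measurableD f g : bounded_measurable f -> bounded_measurable g ->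
  bounded_measurable (fun t => f t + g t).
Proof.
move=> [mf [M fM]] [mg [N gN]]; split; first exact: measurable_funD.
by exists (M + N) => t; rewrite (le_trans (ler_normD _ _))// lerD.
Qed.

Lemma bounded_measurableM f g : bounded_measurable f -> bounded_measurable g ->
  bounded_measurable (fun t => f t * g t).
Proof.
move=> [mf [M fM]] [mg [N gN]]; split; first exact: measurable_funM.
by exists (M * N) => t; rewrite normrM ler_pM.
Qed.

Lemma bounded_measurableX f n : bounded_measurable f ->
  bounded_measurable (fun t => f t ^+ n).
Proof.
move=> bf; elim: n => [|n IH].
  by under eq_fun do rewrite expr0; exact: bounded_measurable_cst.
by under eq_fun do rewrite exprS; exact: bounded_measurableM.
Qed.

Lemma bounded_measurable_sum (I : Type) (s : seq I) (F : I -> T -> R) :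
  (forall i, bounded_measurable (F i)) ->
  bounded_measurable (fun t => \sum_(i <- s) F i t).
Proof.
move=> bF; elim: s => [|i s IH].
  by under eq_fun do rewrite big_nil; exact: bounded_measurable_cst.
by under eq_fun do rewrite big_cons; exact: bounded_measurableD.
Qed.

Variable P : probability T R.

Lemma bounded_measurable_integrable f : bounded_measurable f ->
  P.-integrable [set: T] (EFin \o f).
Proof.
move=> [mf [M fM]]; apply: measurable_bounded_integrable => //.
  by rewrite (le_lt_trans (probability_le1 _ _))// ltry.
exists M; split; first exact: num_real.
by move=> y My t _; rewrite /= (le_trans (fM t))// ltW.
Qed.

Lemma mean_cst a : \int[P]_t a = a.
Proof.
rewrite Rintegral_cst// [X in a * X](_ : _ = 1) ?mulr1//.
exact: (congr1 (@fine R) (probability_setT P)).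
Qed.

Lemma meanD f g : bounded_measurable f -> bounded_measurable g ->
  \int[P]_t (f t + g t) = \int[P]_t f t + \int[P]_t g t.
Proof. by move=> bf bg; rewrite RintegralD//; exact: bounded_measurable_integrable. Qed.

Lemma meanZ a f : bounded_measurable f ->
  \int[P]_t (a * f t) = a * \int[P]_t f t.
Proof. by move=> bf; rewrite RintegralZl//; exact: bounded_measurable_integrable. Qed.

Lemma mean_sum (I : Type) (s : seq I) (F : I -> T -> R) :
  (forall i, bounded_measurable (F i)) ->
  \int[P]_t (\sum_(i <- s) F i t) = \sum_(i <- s) \int[P]_t F i t.
Proof.
move=> bF; elim: s => [|i s IH].
  by under eq_Rintegral do rewrite big_nil; rewrite big_nil mean_cst.
under eq_Rintegral do rewrite big_cons; rewrite big_cons -IH meanD//.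
exact: bounded_measurable_sum.
Qed.

Lemma mean_dist f g (e : R) : bounded_measurable f -> bounded_measurable g ->
  (forall t, `|f t - g t| <= e) -> `|\int[P]_t f t - \int[P]_t g t| <= e.
Proof.
move=> bf bg fg.
have bfg : bounded_measurable (fun t => f t + -1 * g t).
  by apply: bounded_measurableD => //; apply: bounded_measurableM => //;
    exact: bounded_measurable_cst.
rewrite -[X in _ - X]mul1r -mulNr -meanZ// -meanD//; last first.
  by apply: bounded_measurableM => //; exact: bounded_measurable_cst.
apply: le_trans (le_normr_Rintegral _ (bounded_measurable_integrable bfg)) _ => //.
rewrite -[leRHS]mean_cst; apply: le_Rintegral => //.
- apply: (bounded_measurable_integrable (f := fun t => `|f t + -1 * g t|)).
  case: bfg => mfg [M fgM]; split; first exact: measurableT_comp.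
  by exists M => t; rewrite normr_id.
- exact: (bounded_measurable_integrable (bounded_measurable_cst e)).
- by move=> t _; rewrite mulN1r.
Qed.

End BoundedMeasurable.

Lemma mean_prod d1 d2 (T1 : measurableType d1) (T2 : measurableType d2)
    (R : realType) (P : probability T1 R) (Q : probability T2 R)
    (f : T1 -> R) (g : T2 -> R) :
  bounded_measurable f -> bounded_measurable g ->
  \int[(P \x Q)%E]_z (f z.1 * g z.2) = (\int[P]_x f x) * (\int[Q]_y g y).
Proof.
move=> bf bg.
have bfg : bounded_measurable (fun z : T1 * T2 => f z.1 * g z.2).
  case: bf bg => mf [M fM] [mg [N gN]].
  by apply: bounded_measurableM; split;
    [exact: measurableT_comp|exists M|exact: measurableT_comp|exists N].
have ifg := bounded_measurable_integrable (P \x Q)%E bfg.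
rewrite {1}/Rintegral -(integral12_prod_meas1 ifg) /fubini_F/=.
rewrite -RintegralZr//; last exact: bounded_measurable_integrable.
congr fine; apply: eq_integral => x _.
rewrite -RintegralZl; last exact: bounded_measurable_integrable.
  rewrite fineK//; apply: integrable_fin_num => //.
  apply: (bounded_measurable_integrable Q (f := fun y => f x * g y)).
  by apply: bounded_measurableM => //; exact: bounded_measurable_cst.
by [].
Qed.

(** * Measures with a density *)

Section Density.
Context d (T : measurableType d) (R : realType).
Variables (mu : {sigma_finite_measure set T -> \bar R}) (w : T -> R).
Hypotheses (mw : measurable_fun [set: T] w) (w0 : forall t, 0 <= w t).
Hypothesis w1 : (\int[mu]_t (w t)%:E = 1)%E.

Local Notation lambda := (@lebesgue_measure R).

Definition subgraph : set (T * measurableTypeR R) := [set z | 0 <= z.2 <= w z.1].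

Lemma measurable_subgraph : measurable subgraph.
Proof.
have -> : subgraph = [set z | 0 <= z.2] `&` [set z | z.2 <= w z.1].
  by apply/seteqP; split=> z /=; rewrite /subgraph/=; [move/andP|move=> [-> ->]].
apply: measurableI; rewrite -[X in measurable X]setTI.
  by apply: measurable_fun_le => //; exact: measurable_cst.
by apply: measurable_fun_le => //; exact: measurableT_comp.
Qed.

(** The measure of density w is the projection of the product measure on the
    subgraph of w, which reduces integration against it to Fubini. *)
Definition density : set T -> \bar R :=
  pushforward (mrestr (mu \x lambda)%E measurable_subgraph) (@fst T (measurableTypeR R)).

Let density0 : density set0 = 0%E. Proof. exact: measure0. Qed.

Let density_ge0 A : (0 <= density A)%E. Proof. exact: measure_ge0. Qed.

Let density_sigma_additive : semi_sigma_additive density.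
Proof. exact: measure_semi_sigma_additive. Qed.

HB.instance Definition _ := isMeasure.Build _ _ _ density
  density0 density_ge0 density_sigma_additive.

Lemma ge0_integral_density (f : T -> \bar R) :
  measurable_fun [set: T] f -> (forall t, 0 <= f t)%E ->
  (\int[density]_t f t = \int[mu]_t (f t * (w t)%:E))%E.
Proof.
move=> mf f0; rewrite /density ge0_integral_pushforward//= preimage_setT.
have mff : measurable_fun [set: T * measurableTypeR R] (f \o fst).
  exact: measurableT_comp.
rewrite -(setUv subgraph) ge0_integral_setU//; last 4 first.
- exact: measurable_subgraph.
- by apply: measurableC; exact: measurable_subgraph.
- by rewrite setUv.
- by rewrite disj_set2E setICr.
rewrite [X in (_ + X)%E]null_set_integral ?adde0; last 3 first.
- by apply: measurableC; exact: measurable_subgraph.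
- exact: measurable_funTS.
- by rewrite /= /mrestr setICl measure0.
rewrite (@eq_measure_integral _ _ _ subgraph (mu \x lambda)%E); last first.
  by move=> A _ AD; rewrite /= /mrestr setIidl.
rewrite integral_mkcond fubini_tonelli1; last 2 first.
- by apply/measurable_restrict => //; [exact: measurable_subgraph|exact: measurable_funTS].
- by move=> z; rewrite patchE; case: ifP.
apply: eq_integral => t _; rewrite /fubini_F.
transitivity (\int[lambda]_(u in `[0%R, w t]) f t)%E.
  rewrite [RHS]integral_mkcond; apply: eq_integral => u _.
  by rewrite !patchE; congr (if _ then _ else _).
rewrite integral_cst//= lebesgue_measure_itv/= lte_fin.
by have := w0 t; rewrite le_eqVlt => /predU1P[<-|->]; rewrite ?ltxx ?mule0// oppr0 adde0.
Qed.

Let density_setT : density [set: T] = 1%E.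
Proof.
rewrite -w1 -[LHS]mul1e -(@integral_cst _ _ _ density setT measurableT 1%E).
rewrite ge0_integral_density//; first by apply: eq_integral => t _; rewrite mul1e.
Qed.

HB.instance Definition _ := Measure_isProbability.Build _ _ _ density density_setT.

Definition density_probability : probability T R := density.

Lemma integrable_density_weight : mu.-integrable [set: T] (EFin \o w).
Proof.
apply/integrableP; split; first exact/measurable_EFinP.
under eq_integral do rewrite /= ger0_norm//.
by rewrite w1 ltry.
Qed.

(** Adding a constant to f reduces to the case of nonnegative functions. *)
Lemma mean_density (f : T -> R) : bounded_measurable f ->
  \int[density_probability]_t f t = \int[mu]_t (f t * w t).
Proof.
rewrite /density_probability.
move=> bf; have [mf [M fM]] := bf.
have M0 t : 0 <= f t + M by have := fM t; rewrite ler_norml; lra.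
have bM : bounded_measurable (fun _ : T => M) by exact: bounded_measurable_cst.
have ifw : mu.-integrable [set: T] (EFin \o (fun t => f t * w t)).
  have iMw : mu.-integrable [set: T] (EFin \o (fun t => M * w t)).
    exact: (integrableZl measurableT M integrable_density_weight).
  apply: le_integrable iMw => //; first exact/measurable_EFinP/measurable_funM.
  move=> t _; rewrite /= lee_fin !normrM ler_wpM2r//.
  by rewrite (le_trans (fM t))// ler_norm.
apply: (@addIr _ M); rewrite -[X in _ + X = _](mean_cst density).
rewrite -meanD// -[M in RHS]mulr1 -[1](congr1 fine w1).
have iw := integrable_density_weight.
rewrite -[X in _ = _ + _ * X]/(\int[mu]_t w t) -RintegralZl// -RintegralD//; last first.
  exact: (integrableZl measurableT M iw).
rewrite /Rintegral ge0_integral_density//; last first.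
  by apply/measurable_EFinP; exact: measurable_funD.
by congr fine; apply: eq_integral => t _; rewrite -EFinM mulrDl.
Qed.

End Density.

Section Latitude.
Variables (R : realType) (n : nat).

Definition latitude_weight : R -> R :=
  (fun t => sin t ^+ n / beta_trig R 0 n) \_ `[0, pi].

Lemma measurable_latitude_weight : measurable_fun [set: R] latitude_weight.
Proof.
apply/measurable_restrict => //; apply: measurable_funTS.
apply: continuous_measurable_fun => t; apply: cvgM; last exact: cvg_cst.
by apply: continuousX; exact: continuous_sin.
Qed.

Lemma latitude_weight_ge0 t : 0 <= latitude_weight t.
Proof.
rewrite /latitude_weight patchE; case: ifPn => //; rewrite inE/= in_itv/= => t0pi.
by rewrite divr_ge0 ?(ltW (beta_trig_gt0 R n))// exprn_ge0// sin_ge0_pi.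
Qed.

Lemma Rintegral_latitude_weight (f : R -> R) :
  \int[lebesgue_measure]_t (f t * latitude_weight t) =
  integral0pi (fun t => f t * (sin t ^+ n / beta_trig R 0 n)).
Proof.
rewrite /integral0pi [RHS]Rintegral_mkcond; apply: eq_Rintegral => t _.
by rewrite /latitude_weight !patchE; case: ifP => // _; rewrite mulr0.
Qed.

Lemma integral_latitude_weight :
  (\int[lebesgue_measure]_t (latitude_weight t)%:E = 1)%E.
Proof.
rewrite [LHS](_ : _ = \int[lebesgue_measure]_(t in `[0%R, pi])
    ((beta_trig R 0 n)^-1%:E * (cos_sin 0 n t)%:E))%E; last first.
  rewrite [RHS]integral_mkcond; apply: eq_integral => t _.
  rewrite /latitude_weight !patchE; case: ifP => // _.
  by rewrite -EFinM /cos_sin expr0 mul1r mulrC.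
have ics := integrable0pi (@continuous_cos_sin R 0 n).
rewrite integralZl//.
rewrite -[X in (_ * X)%E]fineK; last exact: integrable_fin_num.
by rewrite -EFinM mulVf// gt_eqF// beta_trig_gt0.
Qed.

(** The distribution of the angle to a fixed point of S^(n + 1): the parallel at
    angle t is a copy of S^n of radius sin t. *)
Definition latitude : probability (measurableTypeR R) R :=
  @density_probability _ (measurableTypeR R) R lebesgue_measure latitude_weight
    measurable_latitude_weight latitude_weight_ge0 integral_latitude_weight.

Lemma mean_latitude (f : R -> R) : bounded_measurable f ->
  \int[latitude]_t f t = integral0pi (fun t => f t * (sin t ^+ n / beta_trig R 0 n)).
Proof.
by move=> bf; rewrite /latitude mean_density// Rintegral_latitude_weight.
Qed.

Lemma bounded_measurable_cos_sin p q :
  @bounded_measurable _ (measurableTypeR R) R (cos_sin p q).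
Proof.
apply: bounded_measurableM; apply: bounded_measurableX; split.
- by apply: continuous_measurable_fun; exact: continuous_cos.
- by exists 1; exact: cos_max.
- by apply: continuous_measurable_fun; exact: continuous_sin.
- by exists 1; exact: sin_max.
Qed.

Lemma mean_latitude_cos_sin p q :
  \int[latitude]_t cos_sin p q t = beta_trig R p (n + q) / beta_trig R 0 n.
Proof.
rewrite mean_latitude; last exact: bounded_measurable_cos_sin.
rewrite [RHS]mulrC -integral0piZ; last exact: continuous_cos_sin.
by apply: eq_Rintegral => t _; rewrite /cos_sin exprD; ring.
Qed.

End Latitude.

(** * The moments of the coordinates of a uniform random point *)

Section SphereMoments.
Variable R : realType.
Implicit Types (n k l m : nat).

(** The k-th moment of one coordinate, on the unit n-sphere: for k = 2 m, the product
    of (2 l + 1) / (2 l + n + 1) for l < m. *)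
Definition sphere_moment n k : R :=
  if odd k then 0
  else \prod_(l < k./2) (l.*2.+1%:R / (l.*2 + n).+1%:R).

Lemma sphere_moment_odd n k : odd k -> sphere_moment n k = 0.
Proof. by rewrite /sphere_moment => ->. Qed.

Lemma sphere_moment0 n : sphere_moment n 0 = 1.
Proof. by rewrite /sphere_moment /= big_ord0. Qed.

Lemma sphere_moment_doubleS n l : sphere_moment n l.+1.*2 =
  sphere_moment n l.*2 * (l.*2.+1%:R / (l.*2 + n).+1%:R).
Proof. by rewrite /sphere_moment !odd_double !doubleK big_ord_recr. Qed.

(** The first coordinate cos t of a point of S^(n + 1) has density proportional to
    sin^n t in t. *)
Lemma beta_trig_sphere_moment n k :
  beta_trig R k n / beta_trig R 0 n = sphere_moment n.+1 k.
Proof.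
have B0 : beta_trig R 0 n != 0 by rewrite gt_eqF// beta_trig_gt0.
have [ok|ek] := boolP (odd k); first by rewrite beta_trig_odd// sphere_moment_odd// mul0r.
rewrite -[k]odd_double_half (negPf ek) add0n; elim: k./2 => [|l IH].
  by rewrite divff// sphere_moment0.
rewrite sphere_moment_doubleS -IH doubleS.
have H : (l.*2 + n).+2%:R != 0 :> R by rewrite pnatr_eq0.
have -> : beta_trig R l.*2.+2 n = l.*2.+1%:R * beta_trig R l.*2 n / (l.*2 + n).+2%:R.
  by rewrite -beta_trigSSl mulrAC divff// mul1r.
by rewrite addnS; ring.
Qed.

Lemma bin_double_step l j :
  ('C((l.+1 + j).*2, l.+1.*2) * (l.*2.+2 * l.*2.+1) =
   'C((l.+1 + j).*2, l.*2) * (j.*2.+2 * j.*2.+1))%N.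
Proof.
set N := (l.+1 + j).*2%N.
have e1 : (N - l.*2.+1 = j.*2.+1)%N by rewrite /N; lia.
have e2 : (N - l.*2 = j.*2.+2)%N by rewrite /N; lia.
have := mul_bin_left N l.*2.+1; have := mul_bin_left N l.*2.
by rewrite e1 e2 doubleS => H1 H2; nia.
Qed.

(** The coefficients that make the binomial expansion of the moments of
    S^(n + 1) in terms of those of S^n a power of the squared norm. *)
Lemma sphere_moment_step n l j :
  'C((l + j).*2, l.*2)%:R * (beta_trig R j.*2 (n + l.*2) / beta_trig R 0 n)
    * sphere_moment n l.*2 =
  'C(l + j, l)%:R * sphere_moment n.+1 (l + j).*2.
Proof.
elim: l j => [|l IH] j.
  by rewrite !add0n addn0 !bin0 !mul1r sphere_moment0 mulr1 beta_trig_sphere_moment.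
have -> : 'C(l.+1 + j, l.+1)%:R * sphere_moment n.+1 (l.+1 + j).*2 =
    j.+1%:R / l.+1%:R * ('C(l + j.+1, l)%:R * sphere_moment n.+1 (l + j.+1).*2).
  have E : l.+1%:R * 'C(l.+1 + j, l.+1)%:R = j.+1%:R * 'C(l.+1 + j, l)%:R :> R.
    rewrite -!natrM; congr (_%:R); rewrite mul_bin_left; congr (_ * _)%N; lia.
  rewrite (addnS l j) -(addSn l j) mulrA; congr (_ * _).
  by rewrite mulrAC -E mulrAC mulfV ?mul1r// pnatr_eq0.
rewrite -IH sphere_moment_doubleS (addnS l j) -(addSn l j).
have H1 : j.*2.+1%:R * beta_trig R j.*2 (n + l.+1.*2) =
    (l.*2 + n).+1%:R * beta_trig R j.+1.*2 (n + l.*2).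
  by rewrite !doubleS !addnS beta_trig_parts addnC.
have H2 : 'C((l.+1 + j).*2, l.+1.*2)%:R * (l.*2.+2%:R * l.*2.+1%:R) =
    'C((l.+1 + j).*2, l.*2)%:R * (j.*2.+2%:R * j.*2.+1%:R) :> R.
  by rewrite -!natrM bin_double_step.
have [a0 b0 c0] : [/\ j.*2.+1%:R != 0 :> R, l.*2.+1%:R != 0 :> R & l.+1%:R != 0 :> R].
  by rewrite !pnatr_eq0.
have d0 : (l.*2 + n).+1%:R != 0 :> R by rewrite pnatr_eq0.
have e0 : beta_trig R 0 n != 0 by rewrite gt_eqF// beta_trig_gt0.
have {}H1 : beta_trig R j.*2 (n + l.+1.*2) =
    (l.*2 + n).+1%:R * beta_trig R j.+1.*2 (n + l.*2) / j.*2.+1%:R.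
  by rewrite -H1 mulrAC mulfV// mul1r.
have h0 : l.*2.+2%:R * l.*2.+1%:R != 0 :> R by rewrite mulf_neq0// pnatr_eq0.
have {}H2 : 'C((l.+1 + j).*2, l.+1.*2)%:R =
    'C((l.+1 + j).*2, l.*2)%:R * (j.*2.+2%:R * j.*2.+1%:R) / (l.*2.+2%:R * l.*2.+1%:R) :> R.
  by rewrite -H2 mulfK.
rewrite H1 H2 -(doubleS l) -(doubleS j) -(mul2n l.+1) -(mul2n j.+1) !natrM.
move: a0 b0 c0 d0 e0; set a := j.*2.+1%:R; set b := l.*2.+1%:R; set c := l.+1%:R.
set d := (_ + n).+1%:R; set e := beta_trig _ 0 _; move=> a0 b0 c0 d0 e0.
by field; rewrite e0 -natrD !nat1r !pnatr_eq0.
Qed.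

Lemma sum_even_terms (F : nat -> R) m : (forall i, odd i -> F i = 0) ->
  \sum_(i < m.*2.+1) F i = \sum_(l < m.+1) F l.*2.
Proof.
move=> F0; elim: m => [|m IH]; first by rewrite !big_ord1.
rewrite doubleS big_ord_recr big_ord_recr/= IH [RHS]big_ord_recr/=.
by rewrite F0 ?addr0// /= odd_double.
Qed.

End SphereMoments.

(** * The uniform law on the unit sphere *)

Section UniformLaw.
Variable R : realType.

(** A random point of the unit n-sphere all of whose linear functionals have the
    moments of the uniform law. *)
Definition uniform_on_sphere d (T : measurableType d) (P : probability T R)
    n (phi : T -> 'rV[R]_n.+1) : Prop :=
  [/\ forall i, measurable_fun [set: T] (fun t => phi t 0 i),
      forall t, on_sphere 1 (phi t) &
      forall y k, \int[P]_t (dot (phi t) y ^+ k) = sphere_moment R n k * enorm y ^+ k].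

Lemma bounded_measurable_dot d (T : measurableType d) n (phi : T -> 'rV[R]_n) y :
  (forall i, measurable_fun [set: T] (fun t => phi t 0 i)) ->
  (forall t, on_sphere 1 (phi t)) -> bounded_measurable (fun t => dot (phi t) y).
Proof.
move=> mphi sphi.
apply: (@bounded_measurable_sum _ _ _ _ _ (fun i t => phi t 0 i * y 0 i)) => i.
apply: bounded_measurableM; last exact: bounded_measurable_cst.
split=> //; exists 1 => t; rewrite (le_trans (coord_le_enorm _ _))//.
by apply: enorm_le => //; rewrite (sphi t).
Qed.

(** Adding a constant to f makes it nonnegative. *)
Lemma mean_bernoulli_half (f : bool -> R) :
  \int[bernoulli_prob (2^-1 : R)]_b f b = (f true + f false) / 2.
Proof.
have bf : bounded_measurable f.
  split=> //; exists (`|f true| + `|f false|) => -[]; by rewrite ?lerDl ?lerDr.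
pose M : R := `|f true| + `|f false|.
have M0 b : 0 <= f b + M.
  have := ler_norm (- f true); have := ler_norm (- f false).
  have := normr_ge0 (f true); have := normr_ge0 (f false).
  by rewrite !normrN /M; case: b; lra.
have bM : bounded_measurable (fun _ : bool => M) by exact: bounded_measurable_cst.
apply: (@addIr _ M); rewrite -[X in _ + X = _](mean_cst (bernoulli_prob (2^-1 : R))).
rewrite -meanD// /Rintegral integral_bernoulli_prob//=; last by lra.
by rewrite /unstable.onem; lra.
Qed.

(** S^0 consists of two points. *)
Lemma uniform_on_sphere0 :
  uniform_on_sphere (bernoulli_prob (2^-1 : R))
    (fun b : bool => const_mx (if b then 1 else -1) : 'rV[R]_1).
Proof.
split=> [i|b|y k].
- by under eq_fun do rewrite mxE.
- by rewrite /on_sphere /dot big_ord1 !mxE; case: b; ring.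
rewrite mean_bernoulli_half /dot !big_ord1 !mxE mul1r mulN1r.
rewrite [(- _) ^+ k]exprNn -signr_odd; have [ok|ek] := boolP (odd k).
  by rewrite sphere_moment_odd// expr1 mulN1r subrr !mul0r.
have kE : k = k./2.*2 by rewrite -[LHS]odd_double_half (negPf ek).
have -> : sphere_moment R 0 k = 1.
  rewrite kE; elim: k./2 => [|l IH]; first exact: sphere_moment0.
  by rewrite sphere_moment_doubleS IH mul1r addn0 divff// pnatr_eq0.
rewrite expr0 !mul1r mulrDl -splitr {2}kE -mul2n exprM sqr_enorm /dot big_ord1 -expr2.
by rewrite -exprM mul2n -kE.
Qed.

(** Spherical coordinates: the point of S^(n + 1) at angle t to the first axis, in
    the direction of a point x of the equator S^n. *)
Definition spherical n (x : 'rV[R]_n.+1) (t : R) : 'rV[R]_n.+2 :=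
  \row_i (if unlift ord0 i is Some j then sin t * x 0 j else cos t).

Lemma dot_spherical n (x : 'rV[R]_n.+1) t (y : 'rV[R]_n.+2) :
  dot (spherical x t) y =
  cos t * y 0 ord0 + sin t * dot x (\row_j y 0 (lift ord0 j)).
Proof.
rewrite /dot big_ord_recl mxE unlift_none; congr (_ + _).
by rewrite mulr_sumr; apply: eq_bigr => j _; rewrite !mxE liftK mulrA.
Qed.

Lemma dot_recl n (x y : 'rV[R]_n.+2) : dot x y =
  x 0 ord0 * y 0 ord0 + dot (\row_j x 0 (lift ord0 j)) (\row_j y 0 (lift ord0 j)).
Proof.
by rewrite /dot big_ord_recl; congr (_ + _); apply: eq_bigr => j _; rewrite !mxE.
Qed.

Lemma spherical_on_sphere n (x : 'rV[R]_n.+1) t :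
  on_sphere 1 x -> on_sphere 1 (spherical x t).
Proof.
move=> x1; rewrite /on_sphere dot_spherical mxE unlift_none.
have -> : \row_j spherical x t 0 (lift ord0 j) = sin t *: x.
  by apply/rowP => j; rewrite !mxE liftK.
by rewrite dotZr x1 !expr1n mulr1 -!expr2 cos2Dsin2.
Qed.

(** The inner product of the new point and y is y_0 cos t + <x, y'> sin t. The mean
    of each term in the binomial expansion of its k-th power is a product of a
    moment of x and of a mean of cos^p sin^q. For odd k one of the two factors
    vanishes; for k = 2 m the terms that remain add up to a multiple of
    (y_0^2 + |y'|^2)^m, by [sphere_moment_step]. *)
Lemma uniform_on_sphereS d (T : measurableType d) (P : probability T R) n
    (phi : T -> 'rV[R]_n.+1) : uniform_on_sphere P phi ->
  uniform_on_sphere (P \x latitude R n)%E (fun z => spherical (phi z.1) z.2).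
Proof.
move=> [mphi sphi Mphi]; split=> [i|z|y k]; last first.
- set y0 := y 0 ord0; set y' := \row_j y 0 (lift ord0 j).
  have bdot := bounded_measurable_dot y' mphi sphi.
  pose F i x := 'C(k, i)%:R * y0 ^+ (k - i) * dot (phi x) y' ^+ i.
  have bF i : bounded_measurable (F i).
    apply: bounded_measurableM; first exact: bounded_measurable_cst.
    exact: bounded_measurableX.
  have bFz i : bounded_measurable (fun z : T * measurableTypeR R =>
      F i z.1 * cos_sin (k - i) i z.2).
    have [mF [M FM]] := bF i.
    have [mG [N GN]] := bounded_measurable_cos_sin R (k - i) i.
    apply: bounded_measurableM; split;
      [exact: measurableT_comp|by exists M => z|exact: measurableT_comp|by exists N => z].
  transitivity (\sum_(i < k.+1) \int[(P \x latitude R n)%E]_z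
      (F i z.1 * cos_sin (k - i) i z.2)).
    rewrite -(mean_sum _ _ (fun i => bFz (nat_of_ord i))); apply: eq_Rintegral => z _.
    rewrite dot_spherical exprDn; apply: eq_bigr => i _.
    by rewrite /F /cos_sin !exprMn -mulr_natl; ring.
  pose G i := 'C(k, i)%:R * y0 ^+ (k - i) * (sphere_moment R n i * enorm y' ^+ i) *
    (beta_trig R (k - i) (n + i) / beta_trig R 0 n).
  transitivity (\sum_(i < k.+1) G i).
    apply: eq_bigr => i _; rewrite mean_prod//; last exact: bounded_measurable_cos_sin.
    by rewrite mean_latitude_cos_sin /F meanZ ?Mphi//; exact: bounded_measurableX.
  have [ok|ek] := boolP (odd k).
    rewrite big1 ?sphere_moment_odd ?mul0r// => i _; rewrite /G.
    have [oi|ei] := boolP (odd i); first by rewrite sphere_moment_odd// !(mul0r, mulr0).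
    rewrite beta_trig_odd ?(mul0r, mulr0)// oddB ?ok ?(negPf ei)//.
    by rewrite -ltnS.
  have kE : k = k./2.*2 by rewrite -[LHS]odd_double_half (negPf ek).
  have G0 i : odd i -> G i = 0.
    by move=> oi; rewrite /G sphere_moment_odd// !(mul0r, mulr0).
  have := sum_even_terms k./2 G0; rewrite -kE => ->.
  have -> : enorm y ^+ k = (y0 ^+ 2 + enorm y' ^+ 2) ^+ k./2.
    by rewrite {1}kE -mul2n exprM !sqr_enorm dot_recl -expr2.
  rewrite exprDn mulr_sumr; apply: eq_bigr => l _.
  have lk : (l <= k./2)%N by rewrite -ltnS.
  have := sphere_moment_step R n l (k./2 - l); rewrite subnKC// -kE => E.
  have kl : (k - l.*2 = (k./2 - l).*2)%N by rewrite doubleB -kE.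
  rewrite /G kl -!exprM !mul2n mulrnAr -[RHS]mulr_natl.
  by rewrite [RHS]mulrA -E; ring.
- exact: spherical_on_sphere.
- under eq_fun do rewrite mxE; case: unliftP => [j _|_].
    apply: measurable_funM; last exact: (measurableT_comp (mphi j)).
    apply: measurableT_comp => //.
    by apply: continuous_measurable_fun; exact: continuous_sin.
  apply: measurableT_comp => //.
  by apply: continuous_measurable_fun; exact: continuous_cos.
Qed.

Theorem exists_uniform_on_sphere n : exists d (T : measurableType d)
  (P : probability T R) (phi : T -> 'rV[R]_n.+1), uniform_on_sphere P phi.
Proof.
elim: n => [|n [d [T [P [phi U]]]]].
  by do 4 eexists; exact: uniform_on_sphere0.
by do 4 eexists; exact: uniform_on_sphereS U.
Qed.

End UniformLaw.

(** * The potential of the uniform law *)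

Section SameMoments.
Context d1 d2 (T1 : measurableType d1) (T2 : measurableType d2) (R : realType).
Variables (P1 : probability T1 R) (P2 : probability T2 R).
Variables (X1 : T1 -> R) (X2 : T2 -> R).
Hypotheses (bX1 : bounded_measurable X1) (bX2 : bounded_measurable X2).
Hypothesis X12 : forall k, \int[P1]_t (X1 t ^+ k) = \int[P2]_t (X2 t ^+ k).

Lemma same_moments_horner (p : {poly R}) :
  \int[P1]_t p.[X1 t] = \int[P2]_t p.[X2 t].
Proof.
have H d (T : measurableType d) (P : probability T R) (X : T -> R) :
    bounded_measurable X ->
    \int[P]_t p.[X t] = \sum_(i < size p) p`_i * \int[P]_t (X t ^+ i).
  move=> bX; under eq_Rintegral do rewrite horner_coef.
  rewrite (mean_sum P _ (F := fun (i : 'I_(size p)) t => p`_i * X t ^+ i)).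
    by apply: eq_bigr => i _; rewrite meanZ//; exact: bounded_measurableX.
  move=> i; apply: bounded_measurableM; first exact: bounded_measurable_cst.
  exact: bounded_measurableX.
by rewrite !H//; apply: eq_bigr => i _; rewrite X12.
Qed.

Hypotheses (X1_1 : forall t, -1 <= X1 t <= 1) (X2_1 : forall t, -1 <= X2 t <= 1).

(** The equality holds for polynomials, which approximate f uniformly on the
    common range of X1 and X2. *)
Lemma same_moments_mean (f : R -> R) (M : R) :
  (forall x, -1 <= x <= 1 -> `|f x| <= M) ->
  (forall e : R, 0 < e -> exists2 d : R, 0 < d & forall x y : R, -1 <= x <= 1 ->
     -1 <= y <= 1 -> `|x - y| < d -> `|f x - f y| < e) ->
  measurable_fun [set: T1] (f \o X1) -> measurable_fun [set: T2] (f \o X2) ->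
  \int[P1]_t f (X1 t) = \int[P2]_t f (X2 t).
Proof.
move=> fM fc mf1 mf2.
have bf1 : bounded_measurable (fun t => f (X1 t)) by split=> //; exists M => t; exact: fM.
have bf2 : bounded_measurable (fun t => f (X2 t)) by split=> //; exists M => t; exact: fM.
apply/eqP; rewrite -subr_eq0 -normr_le0; apply/ler_addgt0Pr => e e0; rewrite add0r.
have [|p pf] := weierstrass_approximation fM fc (e := e / 2); first by rewrite divr_gt0.
have bp d (T : measurableType d) (X : T -> R) : bounded_measurable X ->
    bounded_measurable (fun t => p.[X t]).
  move=> bX; under eq_fun do rewrite horner_coef.
  apply: (@bounded_measurable_sum _ _ _ _ _
    (fun (i : 'I_(size p)) t => p`_i * X t ^+ i)) => i.
  apply: bounded_measurableM; first exact: bounded_measurable_cst.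
  exact: bounded_measurableX.
have D1 := mean_dist P1 bf1 (bp _ _ _ bX1) (fun t => pf _ (X1_1 t)).
have D2 := mean_dist P2 bf2 (bp _ _ _ bX2) (fun t => pf _ (X2_1 t)).
rewrite same_moments_horner in D1.
move: D1 D2; rewrite !ler_norml; lra.
Qed.

End SameMoments.

Section Potential.
Variables (R : realType) (r : R).
Hypothesis r0 : 0 < r.

(** exp (- d) as a function of the cosine of the angle. *)
Definition exp_angle (x : R) : R := expR (- (r * acos x)).

Lemma exp_angle_bound x : -1 <= x <= 1 -> `|exp_angle x| <= 1.
Proof.
move=> x1; rewrite ger0_norm ?expR_ge0// -expR0 ler_expR oppr_le0.
by rewrite mulr_ge0 ?(ltW r0)// acos_ge0.
Qed.

Lemma expRN_lipschitz (a b : R) : 0 <= a -> 0 <= b ->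
  `|expR (- a) - expR (- b)| <= `|a - b|.
Proof.
wlog ab : a b / a <= b => [H a0 b0|a0 b0].
  have [ab|/ltW ba] := leP a b; first exact: H.
  by rewrite distrC [leRHS]distrC; exact: H.
rewrite distrC [leRHS]distrC (ger0_norm (x := b - a)) ?subr_ge0//.
rewrite ler0_norm ?subr_le0 ?ler_expR ?lerN2// opprB.
have -> : expR (- b) = expR (- a) * expR (- (b - a)) by rewrite -expRD; congr expR; ring.
have : 1 + - (b - a) <= expR (- (b - a)) by exact: expR_ge1Dx.
have : expR (- a) <= 1 by rewrite -expR0 ler_expR oppr_le0.
have := expR_ge0 (- a).
by nra.
Qed.

Lemma exp_angle_uniform_continuous (e : R) : 0 < e ->
  exists2 d : R, 0 < d & forall x y : R, -1 <= x <= 1 -> -1 <= y <= 1 ->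
    `|x - y| < d -> `|exp_angle x - exp_angle y| < e.
Proof.
move=> e0; pose h := Num.min (e / r) pi.
have h0 : 0 < h by rewrite lt_min divr_gt0//= pi_gt0.
have hpi : 0 < h <= pi by rewrite h0 ge_min lexx orbT.
exists (1 - cos h) => [|x y x1 y1 xy].
  rewrite subr_gt0 -cos0 ltr_cos// in_itv/= ?lexx ?pi_ge0//.
  by rewrite (ltW h0); case/andP: hpi.
have := acos_uniform_continuous x1 y1 hpi xy; rewrite lt_min => /andP[+ _].
rewrite ltr_pdivlMr// mulrC => H; apply: le_lt_trans H.
apply: le_trans (expRN_lipschitz _ _) _; rewrite ?mulr_ge0 ?(ltW r0) ?acos_ge0//.
by rewrite -mulrBr normrM (gtr0_norm r0).
Qed.

Lemma measurable_exp_angle d (T : measurableType d) (X : T -> R) :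
  measurable_fun [set: T] X -> (forall t, -1 <= X t <= 1) ->
  measurable_fun [set: T] (exp_angle \o X).
Proof.
move=> mX X1.
have ma : measurable_fun (`[-1, 1]%classic : set R) exp_angle.
  apply: subspace_continuous_measurable_fun => //.
  apply/subspace_continuousP => x /=; rewrite in_itv/= => x1.
  apply/cvgrPdist_lt => e /exp_angle_uniform_continuous[h h0 hP].
  apply/nbhs_ballP; exists h => // y xy; rewrite /= in_itv/= => y1.
  exact: hP.
have mI : measurable (`[-1, 1]%classic : set R) by [].
apply: (measurable_comp mI _ ma mX).
by move=> _ [t _ <-]; rewrite /= in_itv/=; exact: X1.
Qed.

(** The cosine of the angle to y has the moments of cos t for t distributed as the
    latitude, hence the same mean under [exp_angle]. *)
Theorem mean_exp_angle d (T : measurableType d) (P : probability T R) n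
    (phi : T -> 'rV[R]_n.+2) (y : 'rV[R]_n.+2) :
  uniform_on_sphere P phi -> on_sphere 1 y ->
  \int[P]_t exp_angle (dot (phi t) y) = exp_sin r n / beta_trig R 0 n.
Proof.
move=> [mphi sphi Mphi] y1.
have phi1 t : -1 <= dot (phi t) y <= 1.
  have := cosangle_bound (r := 1) ltr01 (sphi t) y1.
  by rewrite /cosangle expr1n divr1.
have cos1 (t : R) : -1 <= cos t <= 1 by rewrite cos_geN1 cos_le1.
have mcos : measurable_fun [set: measurableTypeR R] (@cos R).
  by apply: continuous_measurable_fun; exact: continuous_cos.
have bcos : @bounded_measurable _ (measurableTypeR R) R cos.
  by split=> //; exists 1; exact: cos_max.
have bdot := bounded_measurable_dot y mphi sphi.
rewrite (@same_moments_mean _ _ _ (measurableTypeR R) _ P (latitude R n) _ cos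
  bdot bcos _ phi1 cos1 exp_angle 1).
- rewrite mean_latitude.
    rewrite [RHS]mulrC -integral0piZ; last exact: continuous_exp_sin.
    apply: eq_Rintegral => t; rewrite inE/= => tpi.
    by rewrite /exp_angle cosK//; ring.
  split; first exact: measurable_exp_angle.
  by exists 1 => t; exact: exp_angle_bound.
- move=> k; rewrite Mphi enormE y1 expr1n sqrtr1 expr1n mulr1.
  rewrite -beta_trig_sphere_moment -[n in beta_trig R k n]addn0.
  rewrite -mean_latitude_cos_sin; apply: eq_Rintegral => t _.
  by rewrite /cos_sin expr0 mulr1.
- exact: exp_angle_bound.
- exact: exp_angle_uniform_continuous.
- by apply: measurable_exp_angle => //; case: bdot.
- exact: measurable_exp_angle.
Qed.

End Potential.

(** * Spaces that carry a measure of constant potential *)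

Section ChargeIntegral.
Context d (T : measurableType d) (R : realType).
Variables (nu : {charge set T -> \bar R}) (mu : {measure set T -> \bar R}).
Hypothesis numu : forall A, measurable A -> nu A = mu A.

(** The negative part of any Hahn decomposition of a positive measure is null. *)
Lemma charge_integral_measure (f : T -> \bar R) :
  charge_integral nu f = (\int[mu]_x f x)%E.
Proof.
rewrite /charge_integral; case: cid => P exN; case: cid => N nuPN.
have neg0 A : measurable A -> jordan_neg nuPN A = 0%E.
  move=> mA; have [[mP _] [mN negN] _ _] := nuPN.
  apply/eqP; rewrite eq_le measure_ge0 andbT jordan_negE cjordan_negE.
  rewrite /crestr0 mem_set// leeNl oppe0 /crestr numu ?measure_ge0//.
  exact: measurableI.
have pos A : measurable A -> jordan_pos nuPN A = mu A.
  move=> mA; rewrite -numu// (jordan_decomp nuPN mA) /cadd /= /cscale /=.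
  have /= -> := neg0 A mA.
  by rewrite mule0 adde0.
rewrite (@eq_measure_integral _ _ _ _ mu (jordan_pos nuPN)); last first.
  by move=> A mA _; exact: pos.
rewrite (@eq_measure_integral _ _ _ _ mzero (jordan_neg nuPN)); last first.
  by move=> A mA _; exact: neg0.
by rewrite integral_measure_zero sube0.
Qed.

End ChargeIntegral.

Section ConstantPotential.
Variables (R : realType) (X : pointedType) (dist : X -> X -> R).
Variables (sigma : probability (borelType dist) R) (c : R).
Hypotheses (c0 : 0 < c) (dist_ge0 : forall x y, 0 <= dist x y).
Hypotheses (dist_sym : forall x y, dist x y = dist y x).

Let K (z : borelType dist * borelType dist) : \bar R := (expR (- dist z.1 z.2))%:E.

Hypothesis mK : measurable_fun [set: borelType dist * borelType dist] K.
Hypothesis sigmaK : forall y : X, (\int[sigma]_x (expR (- dist x y))%:E = c%:E)%E.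

Let K_ge0 z : (0 <= K z)%E. Proof. by rewrite lee_fin expR_ge0. Qed.

Lemma measurable_kernel_section (y : X) : measurable_fun [set: borelType dist]
    (fun x : borelType dist => (expR (- dist x y))%:E).
Proof.
exact: (measurableT_comp mK (pair2_measurable (y : borelType dist))).
Qed.

(* Tonelli's theorem, with the inner integral against sigma constant. *)
Let fubini_potential (mu : {finite_measure set (borelType dist) -> \bar R}) :
  (\int[sigma]_y \int[mu]_x (expR (- dist x y))%:E = c%:E * mu [set: X])%E.
Proof.
rewrite -(fubini_tonelli (m1 := mu) (m2 := sigma) K mK K_ge0).
rewrite -integral_cst//; apply: eq_integral => x _; rewrite -(sigmaK x).
by apply: eq_integral => y _; rewrite /K/= dist_sym.
Qed.

(** The weight measure is sigma / c. For another one, nu = p - n, integrating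
    \int K dp = 1 + \int K dn against sigma gives c p(X) = 1 + c n(X) by Tonelli's
    theorem; the negative part is moved to the right so that all integrands are
    nonnegative. *)
Theorem has_magnitude_constant_potential : has_magnitude dist c^-1.
Proof.
have mKy := measurable_kernel_section.
have cV0 : 0 <= c^-1 by rewrite invr_ge0 ltW.
split.
  pose nu : {charge set (borelType dist) -> \bar R} :=
    cscale c^-1 (charge_of_finite_measure sigma).
  have numu A : measurable A -> nu A = mscale (NngNum cV0) sigma A by [].
  exists nu => y; rewrite (charge_integral_measure numu) ge0_integral_mscale//.
    by rewrite sigmaK/= -EFinM mulVf// gt_eqF.
move=> nu; rewrite /weight_measure /charge_integral.
case: cid => P exN; case: cid => N nuPN nuK.
pose p := jordan_pos nuPN; pose n := jordan_neg nuPN.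
rewrite (jordan_decomp nuPN measurableT) /cadd/= /cscale/=.
have nfin (y : X) : (\int[n]_x (expR (- dist x y))%:E)%E \is a fin_num.
  apply: (@integrable_fin_num _ _ _ n) => //; apply: measurable_bounded_integrable => //.
  - by rewrite -ge0_fin_numE// fin_num_measure.
  - by apply/measurable_EFinP; exact: mKy.
  - exists 1; split; first exact: num_real.
    move=> M M1 x _; rewrite /= ger0_norm ?expR_ge0//.
    by rewrite (le_trans _ (ltW M1))// -expR0 ler_expR oppr_le0.
have pE (y : X) : (\int[p]_x (expR (- dist x y))%:E =
    1 + \int[n]_x (expR (- dist x y))%:E)%E.
  by rewrite -(nuK y) subeK.
have := fubini_potential p.
under eq_integral do rewrite pE.
rewrite ge0_integralD//; last 2 first.
- by move=> y _; apply: integral_ge0 => x _; exact: (K_ge0 (x, y)).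
- exact: (measurable_fun_fubini_tonelli_G K mK K_ge0).
rewrite fubini_potential integral_cst//= mul1e.
have massE (mu : {finite_measure set (borelType dist) -> \bar R}) :
  mu [set: borelType dist] = (fine (mu [set: borelType dist]))%:E.
  by rewrite fineK// fin_num_measure.
have /= pX := massE p; have /= nX := massE n.
rewrite [sigma _](probability_setT sigma) pX nX -!EFinM -!EFinD => -[] H.
congr EFin; apply: (mulfI (lt0r_neq0 c0)).
by rewrite mulfV ?gt_eqF// mulN1r mulrBr -H addrK.
Qed.

End ConstantPotential.

(** * The Borel structure of the sphere, and its magnitude *)

Section SphereBorel.
Variables (R : realType) (n : nat) (r : {posnum R}).
Hypothesis n0 : (0 < n)%N.

Local Notation S := (borelType (@sphere_dist R n r)).

(** Coordinates are 1-Lipschitz for the intrinsic distance. *)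
Lemma measurable_sphere_coord (i : 'I_n.+1) :
  measurable_fun [set: S] (fun x : S => sval x 0 i).
Proof.
apply: (measurability _ (RGenOpens.measurableE R)) => _ [_ [a [b ->] <-]].
rewrite setTI; apply: sub_sigma_algebra => x /=; rewrite in_itv/= => /andP[ax xb].
exists (Num.min (sval x 0 i - a) (b - sval x 0 i)).
  by rewrite lt_min !subr_gt0 ax.
move=> y /=; rewrite sphere_distE// in_itv/= lt_min => /andP[xya xyb].
have [xr yr] := (sval_on_sphere x, sval_on_sphere y).
have := coord_le_enorm (sval x - sval y) i; rewrite !mxE.
have := enorm_le_angle (ltac:(by []) : 0 < r%:num) xr yr.
rewrite ler_norml => xye /andP[]; lra.
Qed.

(** The preimage of an open set is the union of the preimages of the rational
    boxes that meet the sphere inside it. *)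
Lemma measurable_to_sphere d (T : measurableType d) (psi : T -> sphere n r) :
  (forall i, measurable_fun [set: T] (fun t => sval (psi t) 0 i)) ->
  measurable_fun [set: T] (psi : T -> S).
Proof.
move=> mpsi; apply: (@measurability _ _ T S _ _ (metric_open (@sphere_dist R n r))) => //.
move=> _ [U openU <-]; rewrite setTI.
pose box (qk : 'rV[rat]_n.+1 * nat) : set (sphere n r) :=
  [set x : sphere n r | forall i, `|sval x 0 i - ratr (qk.1 0 i)| < qk.2.+1%:R^-1].
rewrite [X in measurable X](_ : _ =
  \bigcup_(qk in [set: 'rV[rat]_n.+1 * nat])
    (if `[< box qk `<=` U >] then psi @^-1` box qk else set0)); last first.
  apply/seteqP; split => [t Ut|t [qk _]]; last by case: asboolP => // qkU /qkU.
  have [e e0 eU] := openU _ Ut.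
  have r0 : 0 < r%:num by [].
  have [d' d'0 dP] := angle_lt n.+1 r0 e0.
  have [h h0 hP] := enorm_lt_coord n.+1 d'0.
  pose k := Num.trunc (2 / h).
  have kh : k.+1%:R^-1 < h / 2.
    rewrite -[h / 2]invrK ltf_pV2 ?posrE ?invr_gt0 ?divr_gt0// invf_div.
    exact: truncnS_gt.
  have k0 : 0 < k.+1%:R^-1 :> R by rewrite invr_gt0.
  have [w wE] : exists w : R, w = k.+1%:R^-1 by exists k.+1%:R^-1.
  rewrite -wE in kh k0.
  have /choice[q qP] (i : 'I_n.+1) : exists q : rat,
      `|sval (psi t) 0 i - ratr q| < w.
    have /rat_in_itvoo[q] : sval (psi t) 0 i - w <
        sval (psi t) 0 i + w by lra.
    by rewrite in_itv/= => qI; exists q; rewrite ltr_norml; lra.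
  exists (\row_i q i, k) => //.
  have tb : box (\row_i q i, k) (psi t) by move=> i /=; rewrite mxE -wE.
  case: asboolP => // -[] x xb; apply: eU => /=; rewrite sphere_distE//.
  apply: dP; [exact: sval_on_sphere|exact: sval_on_sphere|].
  apply: hP => i; rewrite !mxE.
  have /= := tb i; have /= := xb i; rewrite mxE -wE !ltr_norml; lra.
apply: countable_bigcupT_measurable => [|qk]; first exact: countableP.
case: ifP => // _.
rewrite [X in measurable X](_ : _ = \bigcap_(i in [set: 'I_n.+1])
    [set t | `|sval (psi t) 0 i - ratr (qk.1 0 i)| < qk.2.+1%:R^-1]); last first.
  by apply/seteqP; split => t tb i => [_|]; exact: tb.
apply: fin_bigcap_measurable => // i _.
have mf : measurable_fun [set: T] (fun t => `|sval (psi t) 0 i - ratr (qk.1 0 i)|).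
  apply: (measurableT_comp (@normr_measurable R setT)).
  by apply: measurable_funB => //; exact: measurable_cst.
have := mf measurableT _ (@measurable_itv R `]-oo, qk.2.+1%:R^-1[).
by rewrite setTI preimage_itvNyo.
Qed.

Lemma sphere_dist_sym (x y : sphere n r) : sphere_dist x y = sphere_dist y x.
Proof. by rewrite !sphere_distE// angle_sym. Qed.

Lemma sphere_dist_ge0 (x y : sphere n r) : 0 <= sphere_dist x y.
Proof.
by rewrite sphere_distE// mulr_ge0// (angle_ge0 (r := r%:num))//; exact: sval_on_sphere.
Qed.

Lemma exp_sphere_dist (x y : sphere n r) : expR (- sphere_dist x y) =
  exp_angle r%:num (cosangle r%:num (sval x) (sval y)).
Proof. by rewrite sphere_distE. Qed.

Lemma measurable_sphere_kernel : measurable_fun [set: S * S]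
  (fun z : S * S => (expR (- sphere_dist z.1 z.2))%:E).
Proof.
apply/measurable_EFinP; under eq_fun do rewrite exp_sphere_dist.
apply: (@measurable_exp_angle R r%:num _ _ _
  (fun z : S * S => cosangle r%:num (sval z.1) (sval z.2))) => // [|z]; last first.
  by apply: cosangle_bound => //; exact: sval_on_sphere.
apply: measurable_funM; last exact: measurable_cst.
apply: measurable_sum => i; apply: measurable_funM.
  exact: (measurableT_comp (measurable_sphere_coord i) measurable_fst).
exact: (measurableT_comp (measurable_sphere_coord i) measurable_snd).
Qed.

End SphereBorel.

(** The image of the uniform law on the unit sphere under x |-> r x. *)
Lemma sphere_uniform_potential (R : realType) (k : nat) (r : {posnum R}) :
  exists sigma : probability (borelType (@sphere_dist R k.+1 r)) R,
    forall y, (\int[sigma]_x (expR (- sphere_dist x y))%:E =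
      (exp_sin r%:num k / beta_trig R 0 k)%:E)%E.
Proof.
have r0 : 0 < r%:num by [].
have rn0 : r%:num != 0 by [].
have [d [T [P [phi U]]]] := exists_uniform_on_sphere R k.+1.
have [mphi sphi _] := U.
have phir t : enorm (r%:num *: phi t) == r%:num.
  apply/on_sphereE; rewrite /on_sphere dotZl dotZr (sphi t) expr1n mulr1.
  by rewrite expr2.
pose psi t : sphere k.+1 r := exist _ (r%:num *: phi t) (phir t).
have mpsi : measurable_fun [set: T] (psi : T -> borelType (@sphere_dist R k.+1 r)).
  apply: measurable_to_sphere => // i /=; under eq_fun do rewrite mxE.
  by apply: measurable_funM; [exact: measurable_cst|exact: mphi].
pose mfpsi := isMeasurableFun.Build _ _ _ _ _ mpsi.
pose Psi : {mfun T >-> borelType (@sphere_dist R k.+1 r)} :=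
  HB.pack (psi : T -> borelType (@sphere_dist R k.+1 r)) mfpsi.
exists (distribution P Psi) => y; rewrite ge0_integral_distribution; last 2 first.
- exact: (measurable_kernel_section (@measurable_sphere_kernel R k.+1 r (ltn0Sn k))).
- by move=> x; rewrite lee_fin expR_ge0.
pose y1 := r%:num^-1 *: sval y.
have y1s : on_sphere 1 y1.
  by rewrite /on_sphere dotZl dotZr (sval_on_sphere y); field.
rewrite -(mean_exp_angle r0 U y1s).
have bdot := bounded_measurable_dot y1 mphi sphi.
have dot1 t : -1 <= dot (phi t) y1 <= 1.
  have := cosangle_bound (r := 1) ltr01 (sphi t) y1s.
  by rewrite /cosangle expr1n divr1.
rewrite /Rintegral fineK; last first.
  apply: integrable_fin_num => //.
  apply: (bounded_measurable_integrable P
    (f := fun t => exp_angle r%:num (dot (phi t) y1))).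
  split; first by apply: measurable_exp_angle => //; case: bdot.
  by exists 1 => t; exact: exp_angle_bound.
apply: eq_integral => t _; rewrite /= exp_sphere_dist//; congr ((exp_angle _ _)%:E).
by rewrite /cosangle /= dotZl /y1 dotZr; field.
Qed.

Theorem theorem7 (R : realType) (n : nat) (r : {posnum R}) (hn : (1 <= n)%N) :
  has_magnitude (@sphere_dist R n r)
    (if ~~ odd n then
       2 * (\prod_(1 <= k < n | odd k) ((r%:num / k%:R) ^+ 2 + 1))
         / (1 + expR (- (pi * r%:num)))
     else
       pi * r%:num
         * (\prod_(1 <= k < n | ~~ odd k) ((r%:num / k%:R) ^+ 2 + 1))
         / (1 - expR (- (pi * r%:num)))).
Proof.
case: n hn => // k _; rewrite [~~ odd _]negbK -beta_trig_exp_sin//.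
have [sigma sigmaE] := sphere_uniform_potential k r.
rewrite -invf_div; apply: (@has_magnitude_constant_potential _ _ _ sigma).
- by rewrite divr_gt0 ?exp_sin_gt0 ?beta_trig_gt0.
- by move=> x y; exact: sphere_dist_ge0.
- by move=> x y; exact: sphere_dist_sym.
- exact: measurable_sphere_kernel.
- exact: sigmaE.
Qed.
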